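(* Let $N\ge2$ and let $C\subset\mathbb{P}^N$ be an irreducible curve such that $C\cap\Delta_{N-2}=\emptyset$. Then: (1) for every $1\le r\le N$, $\dim\eta_r(C)=r$; (2) for every $p\in\mathbb{P}^N$, $\underline{\operatorname{Hrk}}_C(p)=\operatorname{Hrk}_C(p)\le N$, with equality $\operatorname{Hrk}_C(p)=N$ for generic $p\in\mathbb{P}^N$.
   Context: Work in $\mathbb{P}^N$ over $\mathbb{C}$. Hadamard product: $(p_0:\cdots:p_N)\star(q_0:\cdots:q_N)=(p_0q_0:\cdots:p_Nq_N)$, defined when not all $p_iq_i$ vanish. For varieties $X,Y$, $X\star Y$ is the Zariski closure of $\{p\star q: p\in X,q\in Y, p\star q\text{ defined}\}$; $X^{\star 0}=\{(1:\cdots:1)\}$, $X^{\star s}=X\star X^{\star(s-1)}$. $\operatorname{Hrk}_X(q)=\min\{m\mid q=p_1\star\cdots\star p_m,\ p_i\in X\}$ ($\infty$ if none). $\eta_m(X)=\overline{\{p\mid \operatorname{Hrk}_X(p)\le m\}}=X\cup X^{\star2}\cup\cdots\cup X^{\star m}$. Border Hadamard-$X$-rank: $\underline{\operatorname{Hrk}}_X(p)=\min\{m\mid p\in X^{\star m}\}$ ($\infty$ if none). $\Delta_{N-2}\subset\mathbb{P}^N$ is the set of points with at least two coordinates equal to zero. *)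

(* Defs.v *)
From HB Require Import structures.
From mathcomp Require Import all_boot all_order all_algebra.
From mathcomp Require Import reals.
From mathcomp Require Import complex.
From mathcomp Require Import mpoly.
Set Implicit Arguments. Unset Strict Implicit. Unset Printing Implicit Defensive.
Import Order.TTheory GRing.Theory Num.Theory.
Local Open Scope ring_scope.

Section Proj.
Variable R : realType.
Local Notation C := (R[i]).

(* homogeneous coordinates of a point of P^N: a vector of C^(N+1) *)
Definition pt (N : nat) := 'I_N.+1 -> C.

(* a subset of P^N is represented by a predicate on coordinate vectors;
   only nonzero vectors represent points *)
Definition pset (N : nat) := pt N -> Prop.

Definition nonzero {N} (v : pt N) : Prop := exists i, v i != 0.

Definition is_homog {N} (f : {mpoly C[N.+1]}) : Prop :=
  exists d : nat, f \is ishomog1 d (@mdeg N.+1).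

Definition zclosure {N} (S : pset N) : pset N := fun v =>
  nonzero v /\
  forall f : {mpoly C[N.+1]}, is_homog f ->
    (forall w, S w -> f.@[w] = 0) -> f.@[v] = 0.

Definition psubset {N} (A B : pset N) : Prop := forall v, A v -> B v.

Definition zclosed {N} (S : pset N) : Prop := forall v, S v <-> zclosure S v.

Definition irreducible {N} (S : pset N) : Prop :=
  zclosed S /\ (exists v, S v) /\
  forall A B : pset N, zclosed A -> zclosed B ->
    psubset S (fun v => A v \/ B v) -> psubset S A \/ psubset S B.

Definition irr_chain {N} (S : pset N) (r : nat) : Prop :=
  exists Z : nat -> pset N,
    (forall i, (i <= r)%N -> irreducible (Z i)) /\
    (forall i, (i < r)%N -> psubset (Z i) (Z i.+1) /\ ~ psubset (Z i.+1) (Z i)) /\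
    psubset (Z r) S.

Definition has_dim {N} (S : pset N) (r : nat) : Prop :=
  irr_chain S r /\ ~ irr_chain S r.+1.

Definition irreducible_curve {N} (X : pset N) : Prop :=
  irreducible X /\ has_dim X 1.

Definition Delta {N} : pset N := fun v =>
  nonzero v /\ exists i j : 'I_N.+1, i != j /\ v i = 0 /\ v j = 0.

Definition had {N} (v w : pt N) : pt N := fun i => v i * w i.

Definition hprod {N} (X Y : pset N) : pset N :=
  zclosure (fun u => exists v w, X v /\ Y w /\ nonzero (had v w) /\
                                 forall i, u i = had v w i).

Definition ones {N} : pt N := fun _ => 1.

Fixpoint hpow {N} (X : pset N) (s : nat) : pset N :=
  match s with
  | 0 => zclosure (fun v => forall i, v i = ones i)
  | s'.+1 => hprod X (hpow X s')
  end.

(* q = p_1 * ... * p_m (as points of P^N) with p_j in X *)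
Definition hdecomp {N} (X : pset N) (m : nat) (q : pt N) : Prop :=
  nonzero q /\ exists ps : 'I_m -> pt N, (forall j, X (ps j)) /\
    exists c : C, forall i, q i = c * \prod_(j < m) ps j i.

Definition Hrk_eq {N} (X : pset N) (q : pt N) (m : nat) : Prop :=
  (1 <= m)%N /\ hdecomp X m q /\ forall k, (1 <= k < m)%N -> ~ hdecomp X k q.

Definition bHrk_eq {N} (X : pset N) (q : pt N) (m : nat) : Prop :=
  (1 <= m)%N /\ hpow X m q /\ forall k, (1 <= k < m)%N -> ~ hpow X k q.

Definition Heta {N} (X : pset N) (m : nat) : pset N :=
  zclosure (fun q => exists k, (1 <= k <= m)%N /\ hdecomp X k q).

End Proj.

(* Main.v *)
(** Two coordinates have no common zero on the curve [X], so the graded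
    Nullstellensatz bounds the Hilbert function of [X] linearly, hence that of
    its [r]-fold Hadamard power by a polynomial of degree [r]; since a chain of
    [r + 1] proper inclusions forces growth of degree [r + 1], powers have
    dimension at most [r].  A point of [X] has at most one zero coordinate, so
    for [k <= N] all products of [k] points are defined and the set of such
    products is a linear image of a Segre variety without base points, hence
    closed.  Conversely [X] meets every coordinate hyperplane; multiplying
    points on distinct hyperplanes gives a [k + 1]-fold product with more zeros
    than any [k]-fold product has, so multiplication by a point of [X] without
    zeros makes the powers of [X] into a strict tower.  At height [N] the tower
    must fill [P^N]. *)
Require Import Defs.
From HB Require Import structures.
From mathcomp Require Import all_boot all_order all_algebra.
From mathcomp Require Import perm reals complex mpoly.
From mathcomp Require Import boolp.
From mathcomp Require classical_sets.
From mathcomp Require Import ring lra.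
Set Implicit Arguments. Unset Strict Implicit. Unset Printing Implicit Defensive.
Import Order.TTheory GRing.Theory Num.Theory.
Local Open Scope ring_scope.

(** * The Nullstellensatz over the complex numbers *)

(** [has_dim] speaks of chains only, so no additivity of dimension is at hand. The upper bound
    weighs two counts in one degree: linear conditions that force a form to vanish, against forms
    independent on the top of a chain. The lower bound needs an explicit chain, and the obstacle is
    that the point with all coordinates 1 need not lie on [X], so a power of [X] need not contain
    the previous one; this is why a zero-free point of [X] has to be found. Beyond [N] the count of
    zeros no longer keeps products defined, but the [N]-th power is already everything. The
    Nullstellensatz rests on the uncountability of the field, which avoids maximal ideals. *)

Lemma subinterval_avoiding (R : realFieldType) (s : seq R) (a b : R) : a < b ->
  exists a' b', [/\ a <= a', a' < b', b' <= b &
    forall x, x \in s -> ~~ (a' <= x <= b')].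
Proof.
move=> lt_ab; elim: s => [|x s [a1 [b1 [h1 h2 h3 h4]]]].
  by exists a, b; split.
have [xm|xm] := leP x ((a1 + b1) / 2%:R).
- exists ((a1 + 3%:R * b1) / 4%:R), b1; split => //; [lra|lra|].
  move=> y; rewrite inE => /orP[/eqP->|/h4]; first by apply/negP => /andP[]; lra.
  by apply: contra => /andP[k1 ->]; rewrite andbT; lra.
- exists a1, ((a1 + b1) / 2%:R); split => //; [lra|lra|].
  move=> y; rewrite inE => /orP[/eqP->|/h4]; first by apply/negP => /andP[]; lra.
  by apply: contra => /andP[-> k1] /=; lra.
Qed.

(** Cantor's nested intervals: step [n] shrinks the interval off the list [F n], and the supremum of
    the left endpoints lies in every interval. *)
Lemma not_countable_union_finite (R : realType) (F : nat -> seq R) :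
  exists x, forall n, x \notin F n.
Proof.
pose Q n (p q : R * R) := p.1 < p.2 -> [/\ p.1 <= q.1, q.1 < q.2, q.2 <= p.2 &
    forall x, x \in F n -> ~~ (q.1 <= x <= q.2)].
have H (np : nat * (R * R)) : exists q, Q np.1 np.2 q.
  have [lt|nlt] := boolP (np.2.1 < np.2.2); last by exists np.2; rewrite /Q (negPf nlt).
  by have [a' [b' h]] := subinterval_avoiding (F np.1) lt; exists (a', b').
have [step Hstep] := choice H.
pose I := fix I n := if n is n'.+1 then step (n', I n') else (0 : R, 1 : R).
have IS n : I n.+1 = step (n, I n) by [].
have Ilt n : (I n).1 < (I n).2.
  elim: n => [|n IH]; first by rewrite /= ltr01.
  by rewrite IS; have [] := Hstep (n, I n) IH.
have Imono n m : (n <= m)%N -> (I n).1 <= (I m).1 /\ (I m).2 <= (I n).2.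
  move=> /subnKC <-; elim: (m - n)%N => [|k [h1 h2]]; first by rewrite addn0.
  rewrite addnS IS; have [k1 _ k2 _] := Hstep ((n + k)%N, I (n + k)%N) (Ilt _).
  by split; [exact: le_trans h1 k1|exact: le_trans k2 h2].
have Iall n m : (I n).1 <= (I m).2.
  have [h|/ltnW h] := leqP n m.
    by apply: le_trans (Imono _ _ h).1 (ltW (Ilt _)).
  by apply: le_trans (ltW (Ilt _)) (Imono _ _ h).2.
pose S : R -> Prop := fun x => exists n, x = (I n).1.
have Sne : classical_sets.has_sup S.
  split; first by exists (I 0).1; exists 0.
  by exists (I 0).2 => _ [n ->]; exact: Iall.
exists (sup S) => n; apply/negP; have [_ _ _ h] := Hstep (n, I n) (Ilt n).
move=> /h; rewrite -IS => /negP; apply; apply/andP; split.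
  by apply: sup_upper_bound => //; exists n.+1.
by apply: ge_sup; [case: Sne|move=> _ [m ->]; exact: Iall].
Qed.

(** Otherwise every fibre over the reals is finite and the line a countable union of finite sets.
    The size [M v] depends on [v] because the number of points needed later depends on the degree
    bound that the code records. *)
Lemma large_fiber (R : realType) (code : R[i] -> nat) (M : nat -> nat) :
  exists v (s : seq R[i]), [/\ uniq s, size s = M v & {in s, forall c, code c = v}].
Proof.
apply: contrapT => H.
have fin v : exists F : seq R, forall x : R, code x%:C%C = v -> x \in F.
  apply: contrapT => Hv; apply: H; exists v.
  suff [s [us ss sc]] : exists s : seq R, [/\ uniq s, size s = M v &
      {in s, forall c, code c%:C%C = v}].
    exists [seq x%:C%C | x <- s]; split; rewrite ?size_map //.
      by rewrite map_inj_uniq // => x y [].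
    by move=> _ /mapP[x xs ->]; exact: sc.
  elim: (M v) => [|m [s [us ss sc]]]; first by exists [::].
  have [x [xv xs]] : exists x : R, code x%:C%C = v /\ x \notin s.
    apply: contrapT => Hx; apply: Hv; exists s => x xv.
    by apply: contrapT => /negP xs; apply: Hx; exists x.
  exists (x :: s); split => /=; rewrite ?xs ?ss //.
  by move=> y; rewrite inE => /orP[/eqP->|/sc].
have [F HF] := choice fin.
have [x Hx] := not_countable_union_finite F.
by have := HF _ x erefl; rewrite (negPf (Hx _)).
Qed.

Section Ideals.
Variables (A : comNzRingType).

Definition is_ideal (J : A -> Prop) : Prop :=
  [/\ J 0, (forall p q, J p -> J q -> J (p + q)) & (forall p q, J q -> J (p * q))].

Definition adjoin (J : A -> Prop) (z : A) : A -> Prop :=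
  fun p => exists g, J (p - g * z).

Lemma is_ideal_adjoin J z : is_ideal J -> is_ideal (adjoin J z).
Proof.
move=> [J0 JD JM]; split.
- by exists 0; rewrite mul0r subr0.
- move=> p q [g hg] [h hh]; exists (g + h).
  by rewrite mulrDl opprD addrACA; exact: JD.
- by move=> p q [g hg]; exists (p * g); rewrite -mulrA -mulrBr; exact: JM.
Qed.

Lemma sub_adjoin J z p : J p -> adjoin J z p.
Proof. by move=> h; exists 0; rewrite mul0r subr0. Qed.

Lemma adjoin_gen J z : is_ideal J -> adjoin J z z.
Proof. by move=> [J0 _ _]; exists 1; rewrite mul1r subrr. Qed.

Lemma ideal_sum (J : A -> Prop) (I : Type) (r : seq I) (P : pred I) (F : I -> A) :
  is_ideal J -> (forall i, P i -> J (F i)) -> J (\sum_(i <- r | P i) F i).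
Proof. by move=> [J0 JD _] H; elim/big_ind: _. Qed.

Lemma idealB (J : A -> Prop) p q : is_ideal J -> J p -> J q -> J (p - q).
Proof. by move=> [_ JD JM] hp hq; rewrite -mulN1r; apply: (JD) => //; apply: (JM). Qed.
End Ideals.

Section Nullstellensatz.
Variables (R : realType) (n : nat).
Local Notation C := (R[i]).
Local Notation S := {mpoly C[n]}.

Lemma bounded_mpoly_dependent (D : nat) (I : finType) (g : I -> S) :
  (forall i, msize (g i) <= D)%N -> (#|{: 'X_{1..n < D}}| < #|I|)%N ->
  exists l : I -> C, (exists i, l i != 0) /\ \sum_i l i *: g i = 0.
Proof.
move=> gD cI.
pose M : 'M[C]_(#|I|, #|{: 'X_{1..n < D}}|) :=
  \matrix_(i, j) (g (enum_val i))@_(enum_val j : 'X_{1..n < D}).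
have : kermx M != 0.
  by rewrite kermx_eq0 /row_free neq_ltn (leq_ltn_trans (rank_leq_col _) cI).
case/rowV0Pn => u /sub_kermxP uM u0.
exists (fun i => u 0 (enum_rank i)); split.
  case/rV0Pn: u0 => j uj; exists (enum_val j); by rewrite enum_valK.
apply/mpolyP => m; rewrite raddf_sum mcoeff0 /=.
have [mD|mD] := ltnP (mdeg m) D; last first.
  apply: big1 => i _; rewrite mcoeffZ memN_msupp_eq0 ?mulr0 //.
  by apply: msize_mdeg_ge; apply: leq_trans mD.
move/rowP: uM => /(_ (enum_rank (BMultinom mD))).
rewrite !mxE => {2}<-; rewrite (reindex (@enum_rank I)) /=; last first.
  by exists enum_val => j _; rewrite (enum_rankK, enum_valK).
by apply: eq_bigr => i _; rewrite mcoeffZ !mxE !enum_rankK.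
Qed.

(** Modulo [J] some power [f ^+ k] is a multiple of [y - c], so each linear factor can be removed at
    the cost of raising the exponent of [f] by [k]. *)
Lemma nullstellensatz_split (J : S -> Prop) (f y : S) (h : seq C) (a : nat) :
  is_ideal J -> (forall c, exists k, adjoin J (y - c%:MP) (f ^+ k)) ->
  J (f ^+ a * \prod_(c <- h) (y - c%:MP)) -> exists b, J (f ^+ b).
Proof.
move=> iJ H; elim: h a => [|c h IH] a.
  by rewrite big_nil mulr1; exists a.
rewrite big_cons => hJ; have [k [g hg]] := H c.
have [_ JD JM] := iJ.
apply: (IH (a + k)%N).
have -> : f ^+ (a + k) * \prod_(j <- h) (y - j%:MP) =
   f ^+ a * \prod_(j <- h) (y - j%:MP) * (f ^+ k - g * (y - c%:MP))
   + g * (f ^+ a * ((y - c%:MP) * \prod_(j <- h) (y - j%:MP))).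
  by rewrite exprD; ring.
by apply: (JD); apply: (JM).
Qed.

(* If no value [c] worked, the identities [f ^+ k = g * (y - c)] mod [J], for
   uncountably many [c] with the same [k] and cofactors [g] of the same size,
   would yield a polynomial relation for [y] mod [J]. *)
Lemma nullstellensatz_step (J : S -> Prop) (f y : S) :
  is_ideal J -> (forall k, ~ J (f ^+ k)) ->
  exists c : C, forall k, ~ adjoin J (y - c%:MP) (f ^+ k).
Proof.
move=> iJ Hf; apply: contrapT => Hc.
have H c : exists k, adjoin J (y - c%:MP) (f ^+ k).
  by apply: contrapT => hk; apply: Hc; exists c => k hh; apply: hk; exists k.
have H' c : exists kg : nat * S, J (f ^+ kg.1 - kg.2 * (y - c%:MP)).
  by have [k [g hg]] := H c; exists (k, g).
have [kg Hkg] := choice H'.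
pose code c := pickle ((kg c).1, msize (kg c).2).
(* One more than the number of monomials of degree below [kD.2], which forces a linear relation
   among the cofactors; a number that codes no pair gets size 1. *)
pose M v := if @unpickle (nat * nat)%type v is Some kD then
  #|{: 'X_{1..n < kD.2}}|.+1 else 1%N.
have [v [s [us ss sc]]] := large_fiber code M.
have [x0 x0s] : exists x, x \in s.
  have : (0 < size s)%N by rewrite ss /M; case: unpickle.
  by case: (s) => // x s' _; exists x; rewrite inE eqxx.
set k := (kg x0).1; set D := msize (kg x0).2.
have vE : v = pickle (k, D) by rewrite -(sc _ x0s).
have skD x : x \in s -> (kg x).1 = k /\ msize (kg x).2 = D.
  by move=> /sc; rewrite vE => /(pcan_inj pickleK) [].
pose c (i : 'I_(size s)) := s`_i.
have cs i : c i \in s by exact: mem_nth.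
have cI : injective c by move=> i j /eqP; rewrite nth_uniq // => /eqP /val_inj.
have [||l [[i0 li0] lg]] := @bounded_mpoly_dependent D 'I_(size s) (fun i => (kg (c i)).2).
- by move=> i; rewrite (skD _ (cs i)).2.
- by rewrite card_ord ss vE /M pickleK.
(* Write [g_i] for the cofactor at [c i]. Weighting the interpolation products by [l] makes
   [f ^+ k * h(y)] congruent modulo [J] to the product of [\sum_i l i *: g_i], which is 0, and all
   [y - c i]; yet [h] is nonzero at [c i0]. *)
pose h : {poly C} := \sum_i l i *: \prod_(j | j != i) ('X - (c j)%:P).
have h0 : h != 0.
  apply/eqP => /(congr1 (fun p => p.[c i0])).
  have lj i : (l i *: \prod_(j | j != i) ('X - (c j)%:P)).[c i0] =
      l i * \prod_(j | j != i) (c i0 - c j).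
    by rewrite hornerZ horner_prod; under eq_bigr do rewrite hornerXsubC.
  rewrite horner0 horner_sum (bigD1 i0) //= [X in _ + X]big1 => [|i ii0].
    rewrite addr0 lj => /eqP; rewrite mulf_eq0 (negPf li0) /=.
    move=> /prodf_eq0 [j ji]; rewrite subr_eq0 => /eqP /cI ij.
    by rewrite ij eqxx in ji.
  by rewrite lj (bigD1 i0) 1?eq_sym //= subrr mul0r mulr0.
have [r hr] := closed_field_poly_normal h.
have psiX z : horner_alg y ('X - z%:P) = y - z%:MP.
  by rewrite rmorphB /= horner_algX horner_algC -mul_mpolyC mulr1.
have psiP (T : Type) (t : seq T) (P : pred T) (F : T -> C) :
    horner_alg y (\prod_(i <- t | P i) ('X - (F i)%:P)) =
    \prod_(i <- t | P i) (y - (F i)%:MP).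
  by rewrite rmorph_prod; apply: eq_bigr => i _; exact: psiX.
have Jh : J (f ^+ k * horner_alg y h).
  rewrite /h rmorph_sum mulr_sumr /=.
  have -> : \sum_i f ^+ k * horner_alg y (l i *: \prod_(j | j != i) ('X - (c j)%:P)) =
      \sum_i (l i *: \prod_(j | j != i) (y - (c j)%:MP)) *
         (f ^+ k - (kg (c i)).2 * (y - (c i)%:MP)).
    have -> : \sum_i (l i *: \prod_(j | j != i) (y - (c j)%:MP)) *
         (f ^+ k - (kg (c i)).2 * (y - (c i)%:MP)) =
      \sum_i f ^+ k * horner_alg y (l i *: \prod_(j | j != i) ('X - (c j)%:P)) -
      (\sum_i l i *: (kg (c i)).2) * \prod_i (y - (c i)%:MP).
      rewrite mulr_suml -sumrB; apply: eq_bigr => i _.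
      rewrite [X in _ = _ - _ * X](bigD1 i) //= linearZ /= psiP.
      by rewrite -!mul_mpolyC; ring.
    by rewrite lg mul0r subr0.
  apply: ideal_sum => // i _; have [_ _ JM] := iJ; apply: (JM).
  by rewrite -(skD _ (cs i)).1; exact: Hkg.
have [b] : exists b, J (f ^+ b).
  apply: (@nullstellensatz_split J f y r k iJ H).
  have -> : f ^+ k * \prod_(z <- r) (y - z%:MP) =
     (lead_coef h)^-1%:MP * (f ^+ k * horner_alg y h).
    rewrite {2}hr linearZ /= psiP.
    rewrite -mul_mpolyC [RHS]mulrCA; congr (_ * _).
    by rewrite mulrA -mpolyCM mulr1 -mpolyCM mulVf ?lead_coef_eq0 // mpolyC1 mul1r.
  by have [_ _ JM] := iJ; apply: (JM).
exact: Hf.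
Qed.

(** Fixing variables one at a time replaces the passage to a maximal ideal: once all are fixed,
    every polynomial is congruent to its value at a point. *)
Lemma nullstellensatz_seq (J : S -> Prop) (f : S) (s : seq 'I_n) :
  is_ideal J -> (forall k, ~ J (f ^+ k)) ->
  exists J' : S -> Prop, [/\ is_ideal J', (forall k, ~ J' (f ^+ k)),
    (forall p, J p -> J' p) & {in s, forall i, exists c : C, J' ('X_i - c%:MP)}].
Proof.
move=> iJ Hf; elim: s => [|i s [J1 [i1 f1 s1 c1]]]; first by exists J; split.
have [c hc] := nullstellensatz_step 'X_i i1 f1.
exists (adjoin J1 ('X_i - c%:MP)); split => //.
- exact: is_ideal_adjoin.
- by move=> p /s1; exact: sub_adjoin.
- move=> j; rewrite inE => /orP[/eqP->|/c1 [d hd]].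
    by exists c; apply: adjoin_gen.
  by exists d; apply: sub_adjoin.
Qed.

Theorem nullstellensatz (J : S -> Prop) (f : S) :
  is_ideal J -> (forall k, ~ J (f ^+ k)) ->
  exists c : 'I_n -> C, (forall g, J g -> g.@[c] = 0) /\ f.@[c] != 0.
Proof.
move=> iJ Hf.
have [J' [iJ' f' sJ cJ]] := nullstellensatz_seq (enum 'I_n) iJ Hf.
have H i : exists c : C, J' ('X_i - c%:MP) by apply: cJ; rewrite mem_enum.
have [c hc] := choice H.
have [J0 JD JM] := iJ'.
have cong p : J' (p - (p.@[c])%:MP).
  elim/mpolyind: p => [|a m p _ _ IH]; first by rewrite meval0 subrr.
  rewrite mevalD mpolyCD opprD addrACA; apply: (JD) => //.
  rewrite mevalZ mpolyCM -mul_mpolyC -mulrBr; apply: (JM).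
  rewrite mevalX mpolyXE_id.
  elim/big_rec2: _ => [|i x q _ IHx]; first by rewrite subrr.
  suff Hi e : J' ('X_i ^+ e - (c i ^+ e)%:MP).
    have -> : 'X_i ^+ m i * q - (c i ^+ m i * x)%:MP =
       q * ('X_i ^+ m i - (c i ^+ m i)%:MP) + (c i ^+ m i)%:MP * (q - x%:MP).
      by rewrite mpolyCM; ring.
    by apply: (JD); apply: (JM).
  elim: e => [|e IHe]; first by rewrite !expr0 subrr.
  rewrite !exprS.
  have -> : 'X_i * 'X_i ^+ e - (c i * c i ^+ e)%:MP =
     'X_i * ('X_i ^+ e - (c i ^+ e)%:MP) + (c i ^+ e)%:MP * ('X_i - (c i)%:MP)
       :> {mpoly C[n]}.
    by rewrite mpolyCM; ring.
  by apply: (JD); apply: (JM).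
exists c; split.
  move=> g Jg; apply: contrapT => /eqP gc.
  have := idealB iJ' (sJ _ Jg) (cong g); rewrite opprB addrC subrK => hJ.
  apply: (f' 0%N); rewrite expr0.
  have -> : 1 = (g.@[c])^-1%:MP * (g.@[c])%:MP :> S.
    by rewrite -mpolyCM mulVf // mpolyC1.
  exact: JM.
apply/eqP => fc; apply: (f' 1%N); rewrite expr1.
by have := cong f; rewrite fc mpolyC0 subr0.
Qed.
End Nullstellensatz.

(** * Homogeneous polynomials and the graded Nullstellensatz *)

Section Homogeneous.
Variable K : comNzRingType.

Lemma dhomog_bigprod (n : nat) (I : Type) (r : seq I) (P : pred I)
    (F : I -> {mpoly K[n]}) (e : I -> nat) :
  (forall i, P i -> F i \is (e i).-homog) ->
  \prod_(i <- r | P i) F i \is (\sum_(i <- r | P i) e i).-homog.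
Proof.
move=> H; elim/big_rec2: _ => [|i d p Pi hp]; first exact: dhomog1.
by rewrite dhomogM ?H.
Qed.

Lemma meval_scale (n d : nat) (f : {mpoly K[n]}) (s : K) (v : 'I_n -> K) :
  f \is d.-homog -> f.@[fun i => s * v i] = s ^+ d * f.@[v].
Proof.
move=> /dhomogP hf; rewrite !mevalE mulr_sumr big_seq [RHS]big_seq.
apply: eq_bigr => m /hf md; rewrite mulrCA -md.
congr (_ * _); under eq_bigr do rewrite exprMn.
by rewrite big_split /= prodrXr mdegE.
Qed.

Lemma meval_sum (n : nat) (I : Type) (r : seq I) (P : pred I)
    (F : I -> {mpoly K[n]}) v :
  (\sum_(i <- r | P i) F i).@[v] = \sum_(i <- r | P i) (F i).@[v].
Proof. exact: raddf_sum. Qed.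

Definition pull (m n : nat) (w : 'I_m -> {mpoly K[n]}) (f : {mpoly K[m]}) :=
  f \mPo [tuple w i | i < m].

Lemma meval_pull (m n : nat) (w : 'I_m -> {mpoly K[n]}) f v :
  (pull w f).@[v] = f.@[fun i => (w i).@[v]].
Proof. by rewrite /pull comp_mpoly_meval; apply: meval_eq => i; rewrite tnth_mktuple. Qed.

Lemma dhomog_pull (m n d e : nat) (w : 'I_m -> {mpoly K[n]}) (f : {mpoly K[m]}) :
  (forall i, w i \is e.-homog) -> f \is d.-homog -> pull w f \is (d * e).-homog.
Proof.
move=> hw /dhomogP hf; rewrite /pull comp_mpolyE big_seq rpred_sum // => k /hf kd.
rewrite rpredZ //; have -> : d = (\sum_i k i)%N by rewrite -mdegE -kd.
rewrite big_distrl /=; apply: dhomog_bigprod => i _.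
by rewrite tnth_mktuple mulnC; apply: dhomogMn.
Qed.

Lemma dhomogXi (n : nat) (i : 'I_n) : ('X_i : {mpoly K[n]}) \is 1.-homog.
Proof. by rewrite dhomogX; apply/eqP; exact: mdeg1. Qed.

(** The restriction of [f] to the line through the origin and [v]; its coefficients are the values
    at [v] of the homogeneous components of [f]. *)
Definition radial (n : nat) (v : 'I_n -> K) (f : {mpoly K[n]}) : {poly K} :=
  mmap polyC (fun i => (v i)%:P * 'X) f.

Lemma coef_radial n v (f : {mpoly K[n]}) d :
  (radial v f)`_d = (pihomog mdeg d f).@[v].
Proof.
rewrite /radial /mmap coef_sum pihomogE raddf_sum /= [RHS]big_mkcond /=.
apply: eq_bigr => m _; rewrite /mmap1.
under eq_bigr do rewrite exprMn.
rewrite big_split /= prodrXr -mdegE mulrA.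
have -> : \prod_(i < n) (v i)%:P ^+ m i = (\prod_(i < n) v i ^+ m i)%:P.
  by rewrite rmorph_prod; apply: eq_bigr => i _; rewrite rmorphXn.
rewrite -polyCM coefMXn !coefC.
have [dm|dm|->] := ltngtP; last by rewrite subnn mevalZ mevalX.
- by [].
- by rewrite subn_eq0 leqNgt dm.
Qed.

Lemma horner_radial n v (f : {mpoly K[n]}) s :
  (radial v f).[s] = f.@[fun i => s * v i].
Proof.
rewrite /radial /mmap horner_sum mevalE; apply: eq_bigr => m _.
rewrite hornerM hornerC /mmap1 horner_prod; congr (_ * _).
by apply: eq_bigr => i _; rewrite horner_exp hornerMX hornerC mulrC.
Qed.

Lemma radialM n v (f g : {mpoly K[n]}) : radial v (f * g) = radial v f * radial v g.
Proof. exact: rmorphM. Qed.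

Lemma radialB n v (f g : {mpoly K[n]}) : radial v (f - g) = radial v f - radial v g.
Proof. exact: rmorphB. Qed.

Lemma radial_sum n v (I : Type) (r : seq I) (F : I -> {mpoly K[n]}) :
  radial v (\sum_(i <- r) F i) = \sum_(i <- r) radial v (F i).
Proof. exact: rmorph_sum. Qed.
End Homogeneous.

Lemma poly_eq0_nonzero_roots (K : numFieldType) (p : {poly K}) :
  (forall s, s != 0 -> p.[s] = 0) -> p = 0.
Proof.
move=> H; apply/eqP; apply: contraT => p0.
have := @max_poly_roots _ p [seq i.+1%:R | i <- iota 0 (size p)] p0.
rewrite size_map size_iota ltnn; apply.
  by apply/allP => _ /mapP[i _ ->]; apply/eqP/H; rewrite pnatr_eq0.
by rewrite map_inj_uniq ?iota_uniq // => i j /eqP; rewrite eqr_nat => /eqP[].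
Qed.

Section GradedNullstellensatz.
Variables (R : realType) (n : nat).
Local Notation C := (R[i]).
Local Notation S := {mpoly C[n]}.

(** The nontrivial half of [zclosed], in any number of coordinates: it is applied to Segre varieties
    as well as to subsets of P^N. *)
Definition gclosed (V : ('I_n -> C) -> Prop) : Prop :=
  forall v, (exists i, v i != 0) ->
    (forall d (f : S), f \is d.-homog -> (forall w, V w -> f.@[w] = 0) -> f.@[v] = 0) ->
    V v.

Variable V : ('I_n -> C) -> Prop.
Hypothesis Vclosed : gclosed V.
Hypothesis Vnz : forall v, V v -> exists i, v i != 0.

Lemma gclosed_scale v s : s != 0 -> V v -> V (fun i => s * v i).
Proof.
move=> s0 Vv; apply: Vclosed.
  by have [i vi] := Vnz Vv; exists i; rewrite mulf_neq0.
by move=> d f hf fV; rewrite (meval_scale _ _ hf) fV ?mulr0.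
Qed.

Lemma radial_vanish (h : S) v : (forall w, V w -> h.@[w] = 0) -> V v -> radial v h = 0.
Proof.
move=> hV Vv; apply: poly_eq0_nonzero_roots => s s0.
by rewrite horner_radial hV //; apply: gclosed_scale.
Qed.

Variables (r : nat) (w : 'I_r -> S).
Hypothesis w1 : forall l, w l \is 1.-homog.
Hypothesis wV : forall v, V v -> exists l, (w l).@[v] != 0.

(** The ideal [I(V) + (w)], described by values on the cone [V] so that [I(V)] itself need not be
    handled. *)
Let J (p : S) := exists g : 'I_r -> S,
  forall v, V v -> p.@[v] = \sum_l (w l).@[v] * (g l).@[v].

Let idealJ : is_ideal J.
Proof.
split.
- by exists (fun=> 0) => v _; rewrite meval0 big1 // => l _; rewrite mulr0.
- move=> p q [g hg] [h hh]; exists (fun l => g l + h l) => v Vv.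
  rewrite mevalD hg // hh // -big_split /=; apply: eq_bigr => l _.
  by rewrite mevalD mulrDr.
- move=> p q [g hg]; exists (fun l => p * g l) => v Vv.
  rewrite mevalM hg // mulr_sumr; apply: eq_bigr => l _.
  by rewrite mevalM mulrCA.
Qed.

(** On the line spanned by a point of [V] the relation becomes an identity of polynomials in one
    variable; comparing coefficients of degree [d.+1] lets each [g l] be replaced by its component
    of degree [d]. *)
Let J_homog d (f : S) : f \is d.+1.-homog -> J f ->
  exists g : 'I_r -> S, (forall l, g l \is d.-homog) /\
    forall v, V v -> f.@[v] = \sum_l (w l).@[v] * (g l).@[v].
Proof.
move=> hf [g hg]; exists (fun l => pihomog mdeg d (g l)).
split=> [l|v Vv]; first exact: pihomogP.
have : radial v (f - \sum_l w l * g l) = 0.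
  apply: radial_vanish => // u Vu; rewrite mevalB hg //.
  apply/eqP; rewrite subr_eq0 meval_sum; apply/eqP.
  by apply: eq_bigr => l _; rewrite mevalM.
rewrite radialB radial_sum => /(congr1 (fun p : {poly C} => p`_d.+1)).
rewrite coefB coef0 coef_radial pihomog_dE // coef_sum => /eqP.
rewrite subr_eq0 => /eqP ->; apply: eq_bigr => l _.
rewrite radialM; have -> : radial v (w l) = (w l).@[v]%:P * 'X.
  apply/polyP => k; rewrite coef_radial coefMX coefC.
  have [->|k1] := eqVneq k 1%N; first by rewrite pihomog_dE.
  rewrite (pihomog_ne0 _ (w1 l)) 1?eq_sym // meval0.
  by case: k k1 => [|[|k]].
by rewrite -mulrA coefCM coefXM coef_radial.
Qed.

Theorem graded_nullstellensatz : exists K, forall d, (K <= d)%N ->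
  forall f : S, f \is d.+1.-homog -> exists g : 'I_r -> S,
    (forall l, g l \is d.-homog) /\
    forall v, V v -> f.@[v] = \sum_l (w l).@[v] * (g l).@[v].
Proof.
(* A zero [c] of [J] with [c i != 0] would lie in [V], since [J] contains all forms vanishing on
   [V], and all [w l] would vanish there. *)
have H i : exists k, J ('X_i ^+ k).
  apply: contrapT => Hi.
  have [|c [Jc]] := @nullstellensatz R n J 'X_i idealJ.
    by move=> k Jk; apply: Hi; exists k.
  rewrite mevalXU => ci.
  have /wV [l] : V c.
    apply: Vclosed; first by exists i.
    move=> d f hf fV; apply: Jc; exists (fun=> 0) => v /fV ->.
    by rewrite big1 // => l _; rewrite meval0 mulr0.
  rewrite Jc ?eqxx //; exists (fun j => (j == l)%:R) => v _.
  rewrite (bigD1 l) //= eqxx meval1 mulr1 big1 ?addr0 // => j /negPf ->.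
  by rewrite meval0 mulr0.
have [k Hk] := choice H.
(* A monomial of degree above this sum has some exponent at least [k i]. *)
exists (\sum_i k i)%N => d dK f hf; apply: J_homog => //.
have [_ _ JM] := idealJ.
rewrite [f]mpolyE big_seq; apply: ideal_sum => // m mf; have /dhomogP /(_ m mf) md := hf.
rewrite -mul_mpolyC; apply: (JM).
have [i ki] : exists i, (k i <= m i)%N.
  apply: contrapT => Hm; suff: (mdeg m <= \sum_i k i)%N by rewrite md leqNgt ltnS dK.
  rewrite mdegE; apply: leq_sum => i _; rewrite leqNgt; apply/negP => /ltnW h.
  by apply: Hm; exists i.
have -> : 'X_[m] = 'X_[(m - U_(i) *+ k i)%MM] * 'X_i ^+ k i :> S.
  rewrite mpolyXn -mpolyXD submK //; apply/mnm_lepP => j.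
  by rewrite mulmnE mnm1E; case: eqP => [<-|]; rewrite ?mul1n ?mul0n.
exact: JM.
Qed.
End GradedNullstellensatz.

(** * Closedness of linear images and of Hadamard products *)

Lemma msize_homog (K : nzRingType) (n d : nat) (f : {mpoly K[n]}) :
  f \is d.-homog -> (msize f <= d.+1)%N.
Proof.
move=> hf; rewrite msizeE; apply/bigmax_leqP_seq => m mf _.
by have /dhomogP /(_ m mf) := hf; move=> <-.
Qed.

Lemma meval_homog_bounded (K : comNzRingType) (n d : nat) (f : {mpoly K[n]}) v :
  f \is d.-homog ->
  f.@[v] = \sum_(m : 'X_{1..n < d.+1}) f@_m * (if mdeg m == d then 'X_[m].@[v] else 0).
Proof.
move=> hf; rewrite /meval (@mmapE _ _ _ _ _ f d.+1).
  apply: eq_bigr => m _; case: eqP => [md|/eqP md]; first by rewrite mmapX.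
  by rewrite (dhomog_nemf_coeff hf md) !mul0r.
exact: msize_homog.
Qed.

Section Projection.
Variables (R : realType) (n : nat).
Local Notation C := (R[i]).
Local Notation S := {mpoly C[n]}.
Variable V : ('I_n -> C) -> Prop.
Hypothesis Vclosed : gclosed V.
Hypothesis Vnz : forall v, V v -> exists i, v i != 0.

(* By the graded Nullstellensatz, modulo the linear forms vanishing at [q] the
   monomials of some degree [K] generate those of degree [K.+1]; the
   determinant trick then gives a form vanishing on the image but not at [q]. *)
Theorem linear_image_closed (M : nat) (pr : 'I_M -> S) (q : 'I_M -> C) :
  (forall l, pr l \is 1.-homog) ->
  (forall v, V v -> exists l, (pr l).@[v] != 0) ->
  (exists l, q l != 0) ->
  (forall d (f : {mpoly C[M]}), f \is d.-homog ->
     (forall v, V v -> f.@[fun l => (pr l).@[v]] = 0) -> f.@[q] = 0) ->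
  exists v, V v /\ exists c, forall l, (pr l).@[v] = c * q l.
Proof.
move=> pr1 prV [i0 qi0] qcl; apply: contrapT => Hno.
pose w l := q i0 *: pr l - q l *: pr i0.
have w1 l : w l \is 1.-homog by rewrite rpredB // rpredZ.
have wV v : V v -> exists l, (w l).@[v] != 0.
  move=> Vv; apply: contrapT => Hw; apply: Hno; exists v; split => //.
  exists ((pr i0).@[v] / q i0) => l.
  have : (w l).@[v] = 0 by apply/eqP/negP => /negP h; apply: Hw; exists l.
  rewrite mevalB !mevalZ => /eqP; rewrite subr_eq0 => /eqP h.
  by apply: (mulfI qi0); rewrite h; field.
have [K HK] := graded_nullstellensatz Vclosed Vnz w1 wV.
pose T := 'X_{1..n < K.+1}.
(* [T] lists all monomials of degree at most [K]; those of lower degree get the value 0. *)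
pose b (v : 'I_n -> C) (s : T) := if mdeg s == K then ('X_[s] : S).@[v] else 0.
have Hg (s : T) : exists g : 'I_M -> S, (forall l, g l \is K.-homog) /\
    forall v, V v -> (pr i0).@[v] * b v s = \sum_l (w l).@[v] * (g l).@[v].
  have [sK|sK] := eqVneq (mdeg s) K; last first.
    exists (fun=> 0); split=> [l|v Vv]; first exact: dhomog0.
    by rewrite /b (negPf sK) mulr0 big1 // => l _; rewrite meval0 mulr0.
  have hs : pr i0 * 'X_[s] \is K.+1.-homog.
    by apply: (@dhomogM _ _ _ 1 _ K) => //; rewrite dhomogX; apply/eqP.
  have [g [gh gv]] := HK K (leqnn K) _ hs.
  by exists g; split => // v Vv; rewrite -gv // mevalM /b sK eqxx.
have [g {}Hg] := choice Hg.
pose e (t : 'I_#|{: T}|) : T := enum_val t.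
(* The columns are the relations between [pr i0 * b s] and the [w l * g s l], with new variables in
   place of the [pr l]. At the image of [v] the vector [b v] lies in the left kernel; at [q] the
   forms [w] vanish, which leaves the scalar matrix [q i0]. *)
pose A : 'M[{mpoly C[M]}]_#|{: T}| := \matrix_(t, s)
  ((t == s)%:R *: 'X_i0 -
   \sum_l (g (e s) l)@_(e t) *: (q i0 *: 'X_l - q l *: 'X_i0)).
have A1 t s : A t s \is 1.-homog.
  rewrite mxE rpredB ?rpredZ ?dhomogXi // rpred_sum // => l _.
  by rewrite rpredZ // rpredB ?rpredZ ?dhomogXi.
have detA x : (\det A).@[x] = \det (map_mx (meval x) A) by rewrite det_map_mx.
have hdet : \det A \is (\sum_(i < #|{: T}|) 1).-homog.
  rewrite rpred_sum // => sg _; rewrite mulr_sign.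
  have : \prod_(i < #|{: T}|) A i (sg i) \is (\sum_(i < #|{: T}|) 1).-homog.
    exact: dhomog_bigprod.
  by case: ifP => // _; rewrite dhomogN.
have detV v : V v -> (\det A).@[fun l => (pr l).@[v]] = 0.
  move=> Vv; rewrite detA; apply/eqP/det0P.
  exists (\row_t b v (e t)).
    have [i vi] := Vnz Vv.
    have dK : (mdeg (U_(i) *+ K)%MM < K.+1)%N by rewrite mdegMn mdeg1 mul1n.
    apply/rV0Pn; exists (enum_rank (BMultinom dK)).
    rewrite mxE /e enum_rankK /b /= mdegMn mdeg1 mul1n eqxx.
    by rewrite -mpolyXn rmorphXn /= mevalXU expf_neq0.
  apply/rowP => s; rewrite !mxE.
  have [gh gv] := Hg (e s).
  transitivity ((pr i0).@[v] * b v (e s) - \sum_l (w l).@[v] * (g (e s) l).@[v]);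
    last by rewrite gv // subrr.
  transitivity (\sum_t ((t == s)%:R * (pr i0).@[v] * b v (e t) -
      \sum_l (w l).@[v] * ((g (e s) l)@_(e t) * b v (e t)))).
    apply: eq_bigr => t _; rewrite !mxE mevalB mevalZ mevalXU mulrC mulrBl.
    congr (_ - _); rewrite meval_sum mulr_suml; apply: eq_bigr => l _.
    by rewrite mevalZ /w !mevalB !mevalZ !mevalXU; ring.
  rewrite sumrB; congr (_ - _).
    rewrite (bigD1 s) //= eqxx mul1r big1 ?addr0 // => t /negPf ->.
    by rewrite !mul0r.
  rewrite exchange_big; apply: eq_bigr => l _; rewrite -mulr_sumr.
  congr (_ * _); rewrite (meval_homog_bounded _ (gh l)).
  rewrite (reindex (fun t : 'I_#|{: T}| => e t)) //.
  by exists enum_rank => t _; rewrite /e (enum_valK, enum_rankK).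
have := qcl _ _ hdet detV; rewrite detA.
have -> : map_mx (meval q) A = (q i0)%:M.
  apply/matrixP => t s; rewrite !mxE mevalB mevalZ mevalXU meval_sum big1 ?subr0.
    by rewrite mulr_natl.
  by move=> l _; rewrite mevalZ mevalB !mevalZ !mevalXU mulrC [q l * _]mulrC subrr mul0r.
by rewrite det_scalar => /eqP; rewrite expf_eq0 (negPf qi0) andbF.
Qed.
End Projection.

Section Segre.
Variables (R : realType) (N : nat).
Local Notation C := (R[i]).

Lemma zclosed_scale (X : pset R N) s v : zclosed X -> s != 0 -> X v -> X (fun i => s * v i).
Proof.
move=> cX s0 Xv; have [[i vi] hv] := (cX v).1 Xv; apply/cX; split.
  by exists i; rewrite mulf_neq0.
by move=> f [d fd] fX; rewrite (meval_scale _ _ fd) (hv f) ?mulr0 //; exists d.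
Qed.

Lemma zclosed_nonzero (X : pset R N) v : zclosed X -> X v -> nonzero v.
Proof. by move=> cX /cX []. Qed.

Definition segre (X Y : pset R N) : ('I_(N.+1 * N.+1) -> C) -> Prop :=
  fun z => exists x y, [/\ X x, Y y & forall i j, z (mxvec_index i j) = x i * y j].

Lemma segre_nonzero X Y z : zclosed X -> zclosed Y -> segre X Y z ->
  exists i, z i != 0.
Proof.
move=> cX cY [x [y [Xx Yy zE]]].
have [i xi] := zclosed_nonzero cX Xx; have [j yj] := zclosed_nonzero cY Yy.
by exists (mxvec_index i j); rewrite zE mulf_neq0.
Qed.

(** The 2 x 2 minors make [z] a matrix of rank one, the product of its column [j0] and its row [i0]
    divided by the pivot. A form vanishing on [X] or [Y], evaluated on a column or row, vanishes on
    the Segre set, which puts the factors into [X] and [Y]. *)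
Lemma segre_closed X Y : zclosed X -> zclosed Y -> gclosed (segre X Y).
Proof.
move=> cX cY z [k]; case/mxvec_indexP: k => i0 j0 z0 hz.
have minor i j : z (mxvec_index i j) * z (mxvec_index i0 j0) =
    z (mxvec_index i j0) * z (mxvec_index i0 j).
  pose f : {mpoly C[N.+1 * N.+1]} := 'X_(mxvec_index i j) * 'X_(mxvec_index i0 j0) -
    'X_(mxvec_index i j0) * 'X_(mxvec_index i0 j).
  have /hz hf : f \is 2.-homog.
    by rewrite rpredB //; apply: (@dhomogM _ _ _ 1 _ 1); exact: dhomogXi.
  move: hf; rewrite /f mevalB !mevalM !mevalXU => hf.
  apply/eqP; rewrite -subr_eq0 hf // => w [x [y [_ _ wE]]].
  by rewrite mevalB !mevalM !mevalXU !wE; ring.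
exists (fun i => z (mxvec_index i j0)), (fun j => z (mxvec_index i0 j) / z (mxvec_index i0 j0)).
have hX : X (fun i => z (mxvec_index i j0)).
  apply/cX; split; first by exists i0.
  move=> f [d fd] fX.
  pose w i : {mpoly C[N.+1 * N.+1]} := 'X_(mxvec_index i j0).
  have w1 i : w i \is 1.-homog by exact: dhomogXi.
  have := hz _ _ (dhomog_pull w1 fd).
  rewrite meval_pull (meval_eq (v2 := fun i => z (mxvec_index i j0))); last first.
    by move=> i; rewrite mevalXU.
  apply=> u [x [y [Xx _ uE]]]; rewrite meval_pull.
  rewrite (meval_eq (v2 := fun i => y j0 * x i)) => [|i]; last by rewrite mevalXU uE mulrC.
  by rewrite (meval_scale _ _ fd) fX ?mulr0.
split => //; last by move=> i j; rewrite mulrA -minor mulfK.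
apply/cY; split; first by exists j0; rewrite mulfV ?oner_neq0.
move=> f [d fd] fY.
rewrite (meval_eq (v2 := fun j => (z (mxvec_index i0 j0))^-1 * z (mxvec_index i0 j))).
  rewrite (meval_scale _ _ fd).
  pose w j : {mpoly C[N.+1 * N.+1]} := 'X_(mxvec_index i0 j).
  have w1 i : w i \is 1.-homog by exact: dhomogXi.
  have := hz _ _ (dhomog_pull w1 fd).
  rewrite meval_pull (meval_eq (v2 := fun j => z (mxvec_index i0 j))); last first.
    by move=> i; rewrite mevalXU.
  move=> ->; first by rewrite mulr0.
  move=> u [x [y [_ Yy uE]]]; rewrite meval_pull.
  rewrite (meval_eq (v2 := fun i => x i0 * y i)) => [|i]; last by rewrite mevalXU uE.
  by rewrite (meval_scale _ _ fd) fY ?mulr0.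
by move=> j; rewrite mulrC.
Qed.

Definition hadset (X Y : pset R N) : pset R N :=
  fun u => exists x y, [/\ X x, Y y & forall i, u i = x i * y i].

(** The linear map is the projection of the matrix of products [x i * y j] to its diagonal, and [nz]
    says that it has no base points. *)
Theorem hadset_closed X Y : zclosed X -> zclosed Y ->
  (forall x y, X x -> Y y -> nonzero (had x y)) -> zclosed (hadset X Y).
Proof.
move=> cX cY nz q; split.
  move=> [x [y [Xx Yy qE]]]; split.
    by have [i hi] := nz _ _ Xx Yy; exists i; rewrite qE.
  by move=> f _; apply; exists x, y.
move=> [qnz qcl].
pose pr l : {mpoly C[N.+1 * N.+1]} := 'X_(mxvec_index l l).
have prE l z : (pr l).@[z] = z (mxvec_index l l) by rewrite mevalXU.
have [|v|d f fd fV|v [[x [y [Xx Yy vE]]] [c cE]]] := @linear_image_closed R _ (segre X Y)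
   (segre_closed cX cY) (fun v => @segre_nonzero X Y v cX cY) _ pr q _ _ qnz.
- by move=> l; exact: dhomogXi.
- move=> [x [y [Xx Yy vE]]]; have [i hi] := nz _ _ Xx Yy.
  by exists i; rewrite prE vE.
- apply: qcl; first by exists d.
  move=> u [x [y [Xx Yy uE]]].
  pose z k := mxvec (\matrix_(i, j) (x i * y j)) 0 k.
  have zE i j : z (mxvec_index i j) = x i * y j by rewrite /z mxvecE mxE.
  rewrite -(fV z); last by exists x, y.
  by apply: meval_eq => i; rewrite prE zE uE.
have [i0 hi0] := nz _ _ Xx Yy.
have cq i : x i * y i = c * q i by rewrite -cE prE vE.
have c0 : c != 0.
  by apply: contraNneq hi0 => c0; rewrite /had cq c0 mul0r.
exists (fun i => c^-1 * x i), y; split => //.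
  by apply: zclosed_scale; rewrite ?invr_eq0.
by move=> i; rewrite -mulrA cq mulKf.
Qed.
End Segre.

(** * Hilbert functions *)

Section Spanning.
Variables (R : realType) (N : nat).
Local Notation C := (R[i]).
Local Notation S := {mpoly C[N.+1]}.

Lemma zclosed_gclosed (X : pset R N) : zclosed X -> gclosed X.
Proof.
move=> cX v vnz hv; apply/cX; split => // f [d fd] fX; exact: hv fd fX.
Qed.

(** The generators are arbitrary functions, not forms, which leaves room for an indicator function
    in [hpoly_span_with_ones]. *)
Definition spans (V : pset R N) (d : nat) (T : finType) (G : T -> pt R N -> C) :=
  forall f : S, f \is d.-homog ->
    exists A : T -> C, forall v, V v -> f.@[v] = \sum_t A t * G t v.

Definition hpoly_span (V : pset R N) (s : nat) := exists c, forall d,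
  exists (T : finType) (G : T -> pt R N -> C), (#|T| <= c * d.+1 ^ s)%N /\ spans V d G.

Section FiniteOverForms.
Variables (V : pset R N) (s : nat) (w : 'I_s.+1 -> S) (K D : nat).
Local Notation T := ({ffun 'I_s -> 'I_D.+1} * 'X_{1..N.+1 < K.+1})%type.

(** Monomials in the forms [w] times a monomial of degree at most [K]. The exponent of [w ord0] is
    whatever is missing to degree [e], so only [s] exponents are free and the number of indices
    grows like [D ^ s]; an index of degree above [e] gives 0. *)
Definition gen (e : nat) (t : T) (v : pt R N) : C :=
  if (mdeg t.2 + \sum_i t.1 i <= e)%N then
    (w ord0).@[v] ^+ (e - (mdeg t.2 + \sum_i t.1 i)) *
    \prod_i (w (lift ord0 i)).@[v] ^+ t.1 i * ('X_[t.2] : S).@[v]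
  else 0.

Definition sp (e : nat) (phi : pt R N -> C) :=
  exists A : T -> C, forall v, V v -> phi v = \sum_t A t * gen e t v.

Lemma sp0 e : sp e (fun=> 0).
Proof. by exists (fun=> 0) => v _; rewrite big1 // => t _; rewrite mul0r. Qed.

Lemma spD e phi psi : sp e phi -> sp e psi -> sp e (fun v => phi v + psi v).
Proof.
move=> [A hA] [B hB]; exists (fun t => A t + B t) => v Vv.
by rewrite hA // hB // -big_split /=; apply: eq_bigr => t _; rewrite mulrDl.
Qed.

Lemma spZ e a phi : sp e phi -> sp e (fun v => a * phi v).
Proof.
move=> [A hA]; exists (fun t => a * A t) => v Vv.
by rewrite hA // mulr_sumr; apply: eq_bigr => t _; rewrite mulrA.
Qed.

Lemma sp_eq e phi psi : (forall v, V v -> phi v = psi v) -> sp e psi -> sp e phi.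
Proof. by move=> h [A hA]; exists A => v Vv; rewrite h ?hA. Qed.

Lemma sp_sum e (I : eqType) (r : seq I) (F : I -> pt R N -> C) :
  {in r, forall i, sp e (F i)} -> sp e (fun v => \sum_(i <- r) F i v).
Proof.
elim: r => [|i r IH] H.
  by apply: sp_eq (sp0 e) => v _; rewrite big_nil.
apply: (@sp_eq _ _ (fun v => F i v + \sum_(j <- r) F j v)) => [v _|].
  by rewrite big_cons.
apply: spD; first by apply: H; rewrite mem_head.
by apply: IH => j jr; apply: H; rewrite inE jr orbT.
Qed.

Lemma sp_gen e t : sp e (gen e t).
Proof.
exists (fun t' => (t' == t)%:R) => v _; rewrite (bigD1 t) //= eqxx mul1r big1 ?addr0 //.
by move=> t' /negPf ->; rewrite mul0r.
Qed.

(** Multiplication by [w ord0] keeps the index, by another form it raises one exponent, and [e < D]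
    keeps that exponent within ['I_D.+1]. *)
Lemma sp_mul e l phi : (e < D)%N -> sp e phi -> sp e.+1 (fun v => (w l).@[v] * phi v).
Proof.
move=> eD [A hA].
apply: (@sp_eq _ _ (fun v => \sum_t A t * ((w l).@[v] * gen e t v))).
  by move=> v Vv; rewrite hA // mulr_sumr; apply: eq_bigr => t _; rewrite mulrCA.
apply: sp_sum => -[beta mu] _; apply: spZ.
have [le|gt] := leqP (mdeg mu + \sum_i beta i) e; last first.
  by apply: sp_eq (sp0 _) => v _; rewrite /gen /= leqNgt gt mulr0.
have [i ->|->] := unliftP ord0 l; last first.
  apply: sp_eq (sp_gen e.+1 (beta, mu)) => v _.
  by rewrite /gen /= le leqW // subSn // exprS !mulrA.
have bD : (beta i < D)%N.
  apply: leq_ltn_trans eD; apply: leq_trans le.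
  by rewrite (bigD1 i) //= addnCA leq_addr.
pose beta' : {ffun 'I_s -> 'I_D.+1} := [ffun j => if j == i then inord (beta i).+1 else beta j].
have b'E j : beta' j = (beta j + (j == i))%N :> nat.
  rewrite ffunE; case: eqP => [->|]; last by rewrite addn0.
  by rewrite inordK ?ltnS // addn1.
have sE : (\sum_j beta' j = (\sum_j beta j).+1)%N.
  under eq_bigr do rewrite b'E.
  rewrite big_split /= -[RHS]addn1; congr (_ + _)%N.
  by rewrite (bigD1 i) //= eqxx big1 // => j /negPf ->.
apply: sp_eq (sp_gen e.+1 (beta', mu)) => v _.
rewrite /gen /= le sE addnS ltnS le subSS.
have -> : \prod_j (w (lift ord0 j)).@[v] ^+ beta' j =
    (w (lift ord0 i)).@[v] * \prod_j (w (lift ord0 j)).@[v] ^+ beta j.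
  under eq_bigr do rewrite b'E exprD.
  rewrite big_split /= mulrC; congr (_ * _).
  by rewrite (bigD1 i) //= eqxx expr1 big1 ?mulr1 // => j /negPf ->.
by ring.
Qed.

Hypothesis HK : forall d, (K <= d)%N ->
  forall f : S, f \is d.+1.-homog -> exists g : 'I_s.+1 -> S,
    (forall l, g l \is d.-homog) /\
    forall v, V v -> f.@[v] = \sum_l (w l).@[v] * (g l).@[v].

Lemma sp_small e (f : S) : (e <= K)%N -> f \is e.-homog -> sp e (fun v => f.@[v]).
Proof.
move=> eK hf.
apply: (@sp_eq _ _ (fun v => \sum_(m <- msupp f) f@_m * ('X_[m] : S).@[v])) => [v _|].
  by rewrite {1}[f]mpolyE meval_sum; apply: eq_bigr => m _; rewrite mevalZ.
apply: sp_sum => m mf; apply: spZ.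
have /dhomogP /(_ m mf) md := hf.
have mK : (mdeg m < K.+1)%N by rewrite ltnS md.
apply: sp_eq (sp_gen e ([ffun=> ord0], BMultinom mK)) => v _.
rewrite /gen /= big1 => [|i _]; last by rewrite ffunE.
rewrite addn0 md leqnn subnn mul1r big1 ?mul1r // => i _.
by rewrite ffunE expr0.
Qed.

Lemma sp_homog e (f : S) : (e <= D)%N -> f \is e.-homog -> sp e (fun v => f.@[v]).
Proof.
elim: e f => [|e IH] f eD hf; first exact: sp_small.
have [Ke|eK] := leqP K e; last exact: sp_small.
have [g [gh gv]] := HK Ke hf.
apply: sp_eq gv _; apply: sp_sum => l _; apply: sp_mul => //.
by apply: IH (gh l); exact: ltnW.
Qed.
End FiniteOverForms.

Theorem hpoly_span_of_forms (V : pset R N) (s : nat) (w : 'I_s.+1 -> S) :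
  zclosed V -> (forall l, w l \is 1.-homog) ->
  (forall v, V v -> exists l, (w l).@[v] != 0) -> hpoly_span V s.
Proof.
move=> cV w1 wV.
have Vnz v : V v -> exists i, v i != 0 by move=> /(zclosed_nonzero cV).
have [K HK] := graded_nullstellensatz (zclosed_gclosed cV) Vnz w1 wV.
exists #|{: 'X_{1..N.+1 < K.+1}}| => d.
exists ({ffun 'I_s -> 'I_d.+1} * 'X_{1..N.+1 < K.+1})%type, (gen w (D := d) d).
split; first by rewrite card_prod card_ffun !card_ord mulnC.
by move=> f hf; exact: (@sp_homog V s w K d HK d f (leqnn d) hf).
Qed.

(* An upper bound [#|T|] for the Hilbert function of [Y] in degree [d]: forms of
   degree [d] killed by [#|T|] linear conditions vanish on [Y]. *)
Definition hle (Y : pset R N) (d : nat) (T : finType) (A : 'X_{1..N.+1} -> T -> C) :=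
  forall f : S, f \is d.-homog ->
    (forall t, \sum_(m : 'X_{1..N.+1 < d.+1}) f@_m * A m t = 0) ->
    forall v, Y v -> f.@[v] = 0.

Definition hpoly (Y : pset R N) (s : nat) := exists c, forall d,
  exists (T : finType) (A : 'X_{1..N.+1} -> T -> C), (#|T| <= c * d.+1 ^ s)%N /\ hle Y d A.

Lemma spans_choice (V : pset R N) d (T : finType) (G : T -> pt R N -> C) :
  spans V d G -> exists A : 'X_{1..N.+1} -> T -> C, forall m : 'X_{1..N.+1},
    mdeg m = d -> forall v, V v -> ('X_[m] : S).@[v] = \sum_t A m t * G t v.
Proof.
move=> hG.
have H (m : 'X_{1..N.+1}) : exists A : T -> C,
    mdeg m = d -> forall v, V v -> ('X_[m] : S).@[v] = \sum_t A t * G t v.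
  have [md|md] := eqVneq (mdeg m) d; last by exists (fun=> 0) => e; rewrite e eqxx in md.
  have hm : ('X_[m] : S) \is d.-homog by rewrite dhomogX; apply/eqP.
  by have [A hA] := hG _ hm; exists A.
have [A hA] := choice H.
by exists A.
Qed.

(** Monomials are multiplicative for the Hadamard product: expanding the value at each of the [r]
    factors in the generators and multiplying out leaves one linear condition for each [tau]. *)
Lemma spans_hdecomp (V : pset R N) d (T : finType) (G : T -> pt R N -> C) r :
  spans V d G ->
  exists A : 'X_{1..N.+1} -> {ffun 'I_r -> T} -> C, hle (hdecomp V r) d A.
Proof.
move=> /spans_choice[A hA].
exists (fun m tau => \prod_j A m (tau j)) => f hf f0 q [_ [ps [Vps [c qE]]]].
rewrite (meval_eq (v2 := fun i => c * \prod_j ps j i)) // (meval_scale _ _ hf).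
suff -> : f.@[fun i => \prod_j ps j i] = 0 by rewrite mulr0.
rewrite (meval_homog_bounded _ hf).
transitivity (\sum_(m : 'X_{1..N.+1 < d.+1}) \sum_(tau : {ffun 'I_r -> T})
   f@_m * (\prod_j A m (tau j)) * \prod_j G (tau j) (ps j)).
  apply: eq_bigr => m _; case: eqP => [md|/eqP md]; last first.
    rewrite mulr0 big1 // => tau _; by rewrite (dhomog_nemf_coeff hf md) !mul0r.
  under [RHS]eq_bigr do rewrite -mulrA.
  rewrite -mulr_sumr; congr (_ * _).
  transitivity (\prod_j ('X_[m] : S).@[ps j]).
    rewrite mevalX; under [RHS]eq_bigr do rewrite mevalX.
    by rewrite exchange_big /=; apply: eq_bigr => i _; rewrite prodrXl.
  under eq_bigr do rewrite (hA _ md) //.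
  rewrite bigA_distr_bigA /=; apply: eq_bigr => tau _.
  by rewrite big_split.
rewrite exchange_big big1 // => tau _.
by rewrite -mulr_suml f0 mul0r.
Qed.

Lemma leq_expl a b r : (a <= b)%N -> (a ^ r <= b ^ r)%N.
Proof. by move=> ab; elim: r => // r IH; rewrite !expnS leq_mul. Qed.

Lemma hpoly_hdecomp (V : pset R N) s r : hpoly_span V s -> hpoly (hdecomp V r) (s * r).
Proof.
move=> [c hc]; exists (c ^ r)%N => d; have [T [G [Tc hG]]] := hc d.
have [A hA] := spans_hdecomp r hG; exists {ffun 'I_r -> T}, A; split => //.
by rewrite card_ffun card_ord expnM -expnMn leq_expl.
Qed.

Lemma hpoly_sub (Y Y' : pset R N) s : psubset Y Y' -> hpoly Y' s -> hpoly Y s.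
Proof.
move=> sY [c hc]; exists c => d; have [T [A [Tc hA]]] := hc d.
by exists T, A; split => // f hf f0 v /sY; exact: hA.
Qed.

Lemma hpoly_zclosure (Y : pset R N) s : hpoly Y s -> hpoly (zclosure Y) s.
Proof.
move=> [c hc]; exists c => d; have [T [A [Tc hA]]] := hc d.
exists T, A; split => // f hf f0 v [_]; apply; first by exists d.
exact: hA.
Qed.

(** Padding with the all-one vector turns products of at most [r] factors into products of exactly
    [r], so that one count covers all of [Heta]. *)
Definition with_ones (V : pset R N) : pset R N := fun v => V v \/ forall i, v i = 1.

Lemma hpoly_span_with_ones (V : pset R N) s : hpoly_span V s -> hpoly_span (with_ones V) s.
Proof.
move=> [c hc]; exists c.+1 => d; have [T [G [Tc hG]]] := hc d.
exists (T + unit)%type, (fun o v => if `[< V v >] then (if o is inl t then G t v else 0)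
  else (if o is inl t then 0 else 1)); split.
  by rewrite card_sum card_unit mulSn addnC leq_add // expn_gt0.
move=> f hf; have [A hA] := hG f hf.
exists (fun o => if o is inl t then A t else f.@[fun=> 1]) => v Vv.
rewrite big_sumType /=; case: asboolP => Vv'.
  by rewrite [X in _ + X]big1 => [|t _]; rewrite ?mulr0 // addr0 hA.
case: Vv => // v1; rewrite big1 => [|t _]; last by rewrite mulr0.
rewrite add0r (bigD1 tt) //= big1 => [|[]] //; rewrite mulr1 addr0.
by apply: meval_eq => i; rewrite v1.
Qed.

Lemma hdecomp_with_ones (V : pset R N) k r q : (k <= r)%N -> hdecomp V k q ->
  hdecomp (with_ones V) r q.
Proof.
move=> kr [qnz [ps [Vps [c qE]]]]; split => //.
exists (fun j : 'I_r => if insub (j : nat) is Some j' then ps j' else fun=> 1); split.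
  by move=> j; case: insub => [j'|]; [left|right].
exists c => i; rewrite qE; congr (_ * _).
pose F (j : nat) : C := if (insub j : option 'I_k) is Some j' then ps j' i else 1.
transitivity (\prod_(j < k) F j).
  by apply: eq_bigr => j _; rewrite /F valK.
rewrite (big_ord_widen r F) // big_mkcond /=; apply: eq_bigr => j _.
by rewrite /F; case: insubP => [j' -> _|/negPf ->].
Qed.

Lemma hpoly_Heta (V : pset R N) r : hpoly_span V 1 -> hpoly (Heta V r) r.
Proof.
move=> /hpoly_span_with_ones /(hpoly_hdecomp r); rewrite mul1n => h.
apply: hpoly_zclosure; apply: hpoly_sub h => q [k [/andP[_ kr]]].
exact: hdecomp_with_ones.
Qed.
End Spanning.

(** * Chains of irreducible closed sets *)

Section Chains.
Variables (R : realType) (N : nat).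
Local Notation C := (R[i]).
Local Notation S := {mpoly C[N.+1]}.

Definition vanishes (f : S) (Z : pset R N) := forall v, Z v -> f.@[v] = 0.

(** Primality of the homogeneous vanishing ideal; unlike [irreducible], this form passes readily to
    Hadamard products. *)
Definition prime_set (Z : pset R N) := forall f g : S, is_homog f -> is_homog g ->
  (forall v, Z v -> f.@[v] * g.@[v] = 0) -> vanishes f Z \/ vanishes g Z.

Lemma zclosed_of_sub (Z : pset R N) :
  (forall v, Z v -> nonzero v) -> psubset (zclosure Z) Z -> zclosed Z.
Proof.
move=> nz h v; split; last exact: h.
by move=> Zv; split; [exact: nz|move=> f _; apply].
Qed.

Lemma zclosure_closed (Z : pset R N) : zclosed (zclosure Z).
Proof.
apply: zclosed_of_sub => [v []|v [vnz hv]] //; split => // f hf fZ.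
by apply: hv => // w [_]; apply.
Qed.

Lemma sub_zclosure (Z : pset R N) v : nonzero v -> Z v -> zclosure Z v.
Proof. by move=> nz Zv; split => // f _; apply. Qed.

Lemma not_in_zclosed (Z : pset R N) v : zclosed Z -> nonzero v -> ~ Z v ->
  exists f : S, [/\ is_homog f, vanishes f Z & f.@[v] != 0].
Proof.
move=> cZ vnz nZv; apply: contrapT => H; apply: nZv; apply/cZ; split => // f hf fZ.
by apply: contrapT => /eqP fv; apply: H; exists f.
Qed.

Lemma zclosed_zeros (Z : pset R N) (f : S) : zclosed Z -> is_homog f ->
  zclosed (fun v => Z v /\ f.@[v] = 0).
Proof.
move=> cZ hf; apply: zclosed_of_sub => [v [Zv _]|v [vnz hv]].
  exact: zclosed_nonzero Zv.
split; last by apply: hv => // w [].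
by apply/cZ; split => // g hg gZ; apply: hv => // w [/gZ].
Qed.

Lemma irreducible_prime (Z : pset R N) : irreducible Z -> prime_set Z.
Proof.
move=> [cZ [_ hZ]] f g hf hg fg.
have [v Zv|h|h] := hZ _ _ (zclosed_zeros cZ hf) (zclosed_zeros cZ hg).
- have /eqP := fg v Zv; rewrite mulf_eq0 => /orP[] /eqP h; [left|right] => //.
- by left => v /h [].
- by right => v /h [].
Qed.

Lemma homogM (f g : S) : is_homog f -> is_homog g -> is_homog (f * g).
Proof. by move=> [d hd] [e he]; exists (d + e)%N; apply: dhomogM. Qed.

Lemma prime_irreducible (Z : pset R N) : zclosed Z -> (exists v, Z v) ->
  prime_set Z -> irreducible Z.
Proof.
move=> cZ neZ pZ; split => //; split => // A B cA cB ZAB.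
apply: contrapT => /not_orP[nA nB].
have [v Zv nAv] : exists2 v, Z v & ~ A v.
  by apply: contrapT => H; apply: nA => v Zv; apply: contrapT => nAv; apply: H; exists v.
have [w Zw nBw] : exists2 v, Z v & ~ B v.
  by apply: contrapT => H; apply: nB => w Zw; apply: contrapT => nBw; apply: H; exists w.
have [f [hf fA fv]] := not_in_zclosed cA (zclosed_nonzero cZ Zv) nAv.
have [g [hg gB gw]] := not_in_zclosed cB (zclosed_nonzero cZ Zw) nBw.
have [u Zu|h|h] := pZ f g hf hg.
- by case: (ZAB u Zu) => [/fA|/gB] ->; rewrite ?mul0r ?mulr0.
- by rewrite h ?eqxx in fv.
- by rewrite h ?eqxx in gw.
Qed.

Definition indep (Z : pset R N) (d : nat) (T : finType) (g : T -> S) :=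
  (forall t, g t \is d.-homog) /\
  forall l : T -> C, (forall v, Z v -> \sum_t l t * (g t).@[v] = 0) -> forall t, l t = 0.

Lemma is_homog_comb d (T : finType) (g : T -> S) (l : T -> C) :
  (forall t, g t \is d.-homog) -> \sum_t l t *: g t \is d.-homog.
Proof. by move=> h; rewrite rpred_sum // => t _; rewrite rpredZ. Qed.

(* The new family consists of the [G ^+ j * L ^+ (e * (n - j)) * g t] with
   [j < n]: restricting a relation to [W] isolates the terms with [j = 0], and
   [G] can then be divided out on [Z]. *)
Lemma indep_step (W Z : pset R N) (L G : S) (e d : nat) (T : finType) (g : T -> S) n :
  prime_set W -> prime_set Z -> psubset W Z ->
  L \is 1.-homog -> ~ vanishes L W ->
  G \is e.-homog -> vanishes G W -> ~ vanishes G Z ->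
  indep W d g ->
  exists g' : 'I_n * T -> S, indep Z (e * n + d) g'.
Proof.
move=> pW pZ WZ hL LW hG GW GZ [hg ig].
have GL m j : (j <= m)%N -> G ^+ j * L ^+ (e * (m - j)) \is (e * m).-homog.
  move=> jm; have -> : (e * m = e * j + 1 * (e * (m - j)))%N.
    by rewrite mul1n -mulnDr subnKC.
  by apply: dhomogM; apply: dhomogMn.
exists (fun jt : 'I_n * T => G ^+ jt.1 * L ^+ (e * (n - jt.1)) * g jt.2); split.
  by move=> [j t] /=; apply: dhomogM => //; apply/GL/ltnW.
move=> l.
have LXW k (F : S) : is_homog F -> (forall v, W v -> (L ^+ k).@[v] * F.@[v] = 0) -> vanishes F W.
  move=> hF; elim: k => [|k IH] h.
    by move=> v /h; rewrite expr0 meval1 mul1r.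
  apply: IH; case: (pW L (L ^+ k * F)) => //.
  - by exists 1%N.
  - by apply: homogM => //; exists (1 * k)%N; apply: dhomogMn.
  - by move=> v /h; rewrite exprS !mevalM mulrA.
  - by move=> h' v /h'; rewrite mevalM.
(* Coefficients indexed by [nat] allow the shift to [lam j.+1] in the induction on [m]. *)
suff H m (lam : nat -> T -> C) :
    (forall v, Z v -> \sum_(j < m) (G ^+ j).@[v] * (L ^+ (e * (m - j))).@[v] *
       (\sum_t lam j t *: g t).@[v] = 0) ->
    forall j t, (j < m)%N -> lam j t = 0.
  move=> h [j t].
  have := H n (fun j t => if insub j is Some j' then l (j', t) else 0).
  move=> /(_ _ j t (ltn_ord j)) /=; rewrite valK; apply=> v Zv.
  transitivity (\sum_(k < n) \sum_t' l (k, t') *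
     (G ^+ k * L ^+ (e * (n - k)) * g t').@[v]); last first.
    by rewrite pair_bigA -[RHS](h v Zv); apply: eq_bigr => -[].
  apply: eq_bigr => k _; rewrite meval_sum mulr_sumr; apply: eq_bigr => t' _.
  by rewrite mevalZ valK !mevalM mulrCA.
elim: m lam => // m IH lam h.
pose F0 := \sum_t lam 0%N t *: g t.
have lam0 t : lam 0%N t = 0.
  apply: ig => v Wv; rewrite -[RHS](LXW (e * m.+1)%N F0 _ _ v Wv).
  - by rewrite meval_sum; apply: eq_bigr => u _; rewrite mevalZ.
  - by exists d; apply: is_homog_comb.
  move=> u Wu; rewrite -[RHS](h u (WZ _ Wu)) big_ord_recl /= subn0 expr0 meval1 mul1r.
  rewrite [X in _ = _ + X]big1 ?addr0 // => j _.
  by rewrite /bump add1n exprS !mevalM GW // !mul0r.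
pose P := \sum_(j < m) G ^+ j * L ^+ (e * (m - j)) * \sum_t lam j.+1 t *: g t.
have hP : is_homog P.
  exists (e * m + d)%N; rewrite rpred_sum // => j _; apply: dhomogM.
    exact/GL/ltnW.
  exact: is_homog_comb.
have GP v : Z v -> G.@[v] * P.@[v] = 0.
  move=> Zv; rewrite -[RHS](h v Zv) big_ord_recl /= [X in _ = X + _](_ : _ = 0).
    rewrite add0r meval_sum mulr_sumr; apply: eq_bigr => j _.
    by rewrite /bump add1n subSS exprS !mevalM !mulrA.
  by rewrite meval_sum big1 ?mulr0 // => t _; rewrite lam0 scale0r meval0.
have hG1 : is_homog G by exists e.
have [/GZ //|PZ] := pZ G P hG1 hP GP.
move=> [|j] t; first by rewrite lam0.
rewrite ltnS => jm; apply: (IH (fun j => lam j.+1)) => // v Zv.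
by rewrite -[RHS](PZ v Zv) meval_sum; apply: eq_bigr => k _; rewrite !mevalM.
Qed.

Lemma indep_chain (Z : nat -> pset R N) r :
  (forall i, (i <= r)%N -> irreducible (Z i)) ->
  (forall i, (i < r)%N -> psubset (Z i) (Z i.+1) /\ ~ psubset (Z i.+1) (Z i)) ->
  exists E, forall n, exists (T : finType) (g : T -> S),
    #|T| = (n ^ r)%N /\ indep (Z r) (E * n) g.
Proof.
move=> irr inc.
(* A point of the smallest member lies in every [Z i]; a coordinate nonzero there serves as the form
   [L] at every step. *)
have [v0 Zv0] := (irr 0%N isT).2.1.
have [i0 vi0] := zclosed_nonzero (irr 0%N isT).1 Zv0.
have Zi i : (i <= r)%N -> Z i v0.
  by elim: i => // i IH ir; apply: (inc i ir).1; apply: IH; exact: ltnW.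
suff H i : (i <= r)%N -> exists E, forall n, exists (T : finType) (g : T -> S),
    #|T| = (n ^ i)%N /\ indep (Z i) (E * n) g by exact: H.
elim: i => [|i IH] ir.
  exists 0%N => n; exists unit, (fun=> 1); rewrite card_unit; split => //.
  split=> [_|l hl []]; first exact: dhomog1.
  by have := hl v0 Zv0; rewrite (bigD1 tt) //= big1 => [|[]] //; rewrite meval1 mulr1 addr0.
have [E hE] := IH (ltnW ir).
have [Zii nZii] := inc i ir.
have [v Zv nZv] : exists2 v, Z i.+1 v & ~ Z i v.
  by apply: contrapT => h; apply: nZii => v Zv; apply: contrapT => nZv; apply: h; exists v.
have [G [[e hG] GZ Gv]] := not_in_zclosed (irr i (ltnW ir)).1
   (zclosed_nonzero (irr _ ir).1 Zv) nZv.
exists (e + E)%N => n; have [T [g [Tn ig]]] := hE n.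
have LZ : ~ vanishes 'X_i0 (Z i).
  by move=> /(_ v0 (Zi i (ltnW ir))); rewrite mevalXU; apply/eqP.
have GZ1 : ~ vanishes G (Z i.+1) by move=> /(_ v Zv); apply/eqP.
have [g' ig'] := indep_step n (irreducible_prime (irr i (ltnW ir)))
  (irreducible_prime (irr _ ir)) Zii (dhomogXi _ i0) LZ hG GZ GZ1 ig.
exists ('I_n * T)%type, g'; rewrite mulnDl; split => //.
by rewrite card_prod card_ord Tn expnS.
Qed.

(** Among [n ^ s.+1] independent forms of degree [E * n], too few conditions leave a nontrivial
    combination that vanishes on [Y], hence on the top of the chain. *)
Theorem no_long_chain (Y : pset R N) s : hpoly Y s -> ~ irr_chain Y s.+1.
Proof.
move=> [c hc] [Z [irr [inc ZY]]].
have [E hE] := indep_chain irr inc.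
(* Since [(E * n).+1 <= E.+1 * n], this choice makes [n ^ s.+1] exceed the number of conditions. *)
pose n := (c * E.+1 ^ s).+1.
have [T [g [Tn [hg ig]]]] := hE n.
have [U [A [Uc hA]]] := hc (E * n)%N.
have UT : (#|U| < #|T|)%N.
  rewrite Tn; apply: leq_ltn_trans Uc _.
  apply: (@leq_ltn_trans (c * (E.+1 ^ s * n ^ s))%N).
    rewrite leq_mul2l -expnMn leq_expl ?orbT // mulSn -add1n.
    by rewrite leq_add2r.
  by rewrite mulnA expnS ltn_pmul2r ?expn_gt0.
pose d := (E * n)%N.
pose M : 'M[C]_(#|T|, #|U|) := \matrix_(t, u)
  \sum_(m : 'X_{1..N.+1 < d.+1}) (g (enum_val t))@_m * A m (enum_val u).
have : kermx M != 0.
  by rewrite kermx_eq0 /row_free neq_ltn (leq_ltn_trans (rank_leq_col _) UT).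
case/rowV0Pn => x /sub_kermxP xM /rV0Pn[j xj].
pose l t := x 0 (enum_rank t).
pose f := \sum_t l t *: g t.
have hf : f \is d.-homog by exact: is_homog_comb.
suff : l (enum_val j) = 0 by rewrite /l enum_valK => e; rewrite e eqxx in xj.
apply: ig => v /ZY Yv.
transitivity f.@[v]; first by rewrite meval_sum; apply: eq_bigr => t _; rewrite mevalZ.
apply: (hA f hf) Yv => u.
move/rowP: xM => /(_ (enum_rank u)); rewrite !mxE => {2}<-.
transitivity (\sum_t l t * \sum_(m : 'X_{1..N.+1 < d.+1}) (g t)@_m * A m u).
  under [RHS]eq_bigr do rewrite mulr_sumr.
  rewrite exchange_big; apply: eq_bigr => m _.
  rewrite /f [(\sum_t _)@_m]raddf_sum mulr_suml; apply: eq_bigr => t _.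
  by rewrite /= mcoeffZ mulrA.
rewrite (reindex (fun t : 'I_#|T| => enum_val t)) /=; last first.
  by exists enum_rank => t _; rewrite (enum_valK, enum_rankK).
by apply: eq_bigr => t _; rewrite !mxE /l enum_valK enum_rankK.
Qed.
End Chains.

(** * Hadamard powers *)

Section PrimeSets.
Variables (R : realType) (N : nat).
Local Notation C := (R[i]).
Local Notation S := {mpoly C[N.+1]}.

Definition twist (u : pt R N) (f : S) : S := pull (fun i => u i *: 'X_i) f.

Lemma meval_twist u f v : (twist u f).@[v] = f.@[had u v].
Proof. by rewrite /twist meval_pull; apply: meval_eq => i; rewrite mevalZ mevalXU. Qed.

Lemma is_homog_twist u f : is_homog f -> is_homog (twist u f).
Proof.
move=> [d hd]; exists (d * 1)%N; apply: dhomog_pull => // i.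
by rewrite rpredZ // dhomogXi.
Qed.

Lemma meval_twist2 u u' f g v v' :
  (twist u f).@[v] * (twist u' g).@[v'] = f.@[had u v] * g.@[had u' v'].
Proof. exact: congr2 (meval_twist u f v) (meval_twist u' g v'). Qed.

(** For each [z] in [X], primality of [Y] makes [f] or [g] vanish on the multiple of [Y] by [z].
    With [y] and [y'] taken from points of nonvanishing, the product of [twist y f] and [twist y' g]
    then vanishes on [X], against primality of [X]. *)
Lemma prime_hadset (X Y : pset R N) : prime_set X -> prime_set Y -> prime_set (hadset X Y).
Proof.
move=> pX pY f g hf hg fg; apply: contrapT => /not_orP[nf ng].
have wit h : ~ vanishes h (hadset X Y) ->
    exists x y, [/\ X x, Y y & h.@[had x y] != 0].
  move=> nh; apply: contrapT => H; apply: nh => v [x [y [Xx Yy vE]]].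
  rewrite (meval_eq (v2 := had x y)) //; apply: contrapT => /eqP k.
  by apply: H; exists x, y.
have [x [y [Xx Yy /eqP fxy]]] := wit f nf; have [x' [y' [Xx' Yy' /eqP gxy]]] := wit g ng.
have hadE a b h : (twist b h).@[a] = h.@[had a b].
  by rewrite meval_twist; apply: meval_eq => i; rewrite /had mulrC.
have alt z : X z -> vanishes (twist z f) Y \/ vanishes (twist z g) Y.
  move=> Xz; apply: pY; [exact: is_homog_twist|exact: is_homog_twist|].
  by move=> u Yu; rewrite meval_twist2; apply: (fg (had z u)); exists z, u.
case: (pX (twist y f) (twist y' g)) => [||z Xz|h|h].
- exact: is_homog_twist.
- exact: is_homog_twist.
- apply/eqP; rewrite mulf_eq0; apply/orP; case: (alt z Xz) => h; [left|right]; apply/eqP.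
    exact: etrans (hadE z y f) (etrans (esym (meval_twist z f y)) (h y Yy)).
  exact: etrans (hadE z y' g) (etrans (esym (meval_twist z g y')) (h y' Yy')).
- exact: fxy (etrans (esym (hadE x y f)) (h x Xx)).
- exact: gxy (etrans (esym (hadE x' y' g)) (h x' Xx')).
Qed.

Definition translate (u : pt R N) (Y : pset R N) : pset R N := fun v => Y (had u v).

Lemma translate_closed u Y : (forall i, u i != 0) -> zclosed Y -> zclosed (translate u Y).
Proof.
move=> u0 cY; apply: zclosed_of_sub => [v Yv|v [[i vi] hv]].
  by have [k] := zclosed_nonzero cY Yv; rewrite mulf_eq0 negb_or => /andP[_ h]; exists k.
apply/cY; split; first by exists i; rewrite mulf_neq0.
move=> f hf fY; rewrite -meval_twist; apply: hv; first exact: is_homog_twist.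
by move=> w /fY; rewrite meval_twist.
Qed.

Lemma translate_prime u Y : (forall i, u i != 0) -> prime_set Y -> prime_set (translate u Y).
Proof.
move=> u0 pY f g hf hg fg; pose u' : pt R N := fun i => (u i)^-1.
have uK (w : pt R N) : had u (had u' w) = w by apply: funext => i; rewrite /had mulVKf.
have u'K (w : pt R N) : had u' (had u w) = w by apply: funext => i; rewrite /had mulKf.
have back h : vanishes (twist u' h) Y -> vanishes h (translate u Y).
  by move=> hY v /hY; rewrite meval_twist u'K.
have := pY (twist u' f) (twist u' g) (is_homog_twist _ hf) (is_homog_twist _ hg).
case=> [w Yw|/back h|/back h]; [|by left|by right].
by rewrite meval_twist2; apply: fg; rewrite /translate uK.
Qed.

Lemma nonzero_closed : zclosed (@nonzero R N).
Proof. by apply: zclosed_of_sub => [v //|v []]. Qed.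

Lemma nonzero_prime : prime_set (@nonzero R N).
Proof.
move=> f g hf hg fg; apply: contrapT => /not_orP[nf ng].
have wit h : ~ vanishes h (@nonzero R N) -> exists v : pt R N, nonzero v /\ h.@[v] != 0.
  move=> nh; apply: contrapT => H; apply: nh => v vnz.
  by apply: contrapT => /eqP k; apply: H; exists v.
have [v [[i vi] fv]] := wit f nf; have [w [_ gw]] := wit g ng.
pose line (h : S) : {poly C} := mmap polyC (fun i => (v i)%:P + 'X * (w i - v i)%:P) h.
have lineE h s : (line h).[s] = h.@[fun i => v i + s * (w i - v i)].
  rewrite /line /mmap horner_sum mevalE; apply: eq_bigr => m _.
  rewrite hornerM hornerC /mmap1 horner_prod; congr (_ * _).
  by apply: eq_bigr => j _; rewrite horner_exp !hornerE.
(* The third factor is 0 wherever the line may pass through the origin, where [fg] says nothing. *)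
have : line f * line g * line 'X_i = 0.
  apply: poly_eq0_nonzero_roots => s _; rewrite !hornerM !lineE mevalXU.
  have [->|nz] := eqVneq (v i + s * (w i - v i)) 0; first by rewrite mulr0.
  by rewrite fg ?mul0r //; exists i.
move/eqP; rewrite !mulf_eq0 -orbA => /or3P[] /eqP h.
- move: (lineE f 0); rewrite h horner0 => /esym/eqP; apply/negP.
  by rewrite (meval_eq (v2 := v)) // => j; rewrite mul0r addr0.
- move: (lineE g 1); rewrite h horner0 => /esym/eqP; apply/negP.
  by rewrite (meval_eq (v2 := w)) // => j; rewrite mul1r addrC subrK.
- move: (lineE 'X_i 0); rewrite h horner0 mevalXU mul0r addr0 => /esym/eqP.
  by apply/negP.
Qed.

Lemma hpoly_nonzero : hpoly (@nonzero R N) N.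
Proof.
have := @hpoly_span_of_forms R N (@nonzero R N) N (fun l => 'X_l) nonzero_closed.
move=> /(_ (dhomogXi _ (n:=N.+1))) h.
have /h/(hpoly_hdecomp 1) : forall v : pt R N, nonzero v -> exists l, ('X_l : S).@[v] != 0.
  by move=> v [i vi]; exists i; rewrite mevalXU.
rewrite muln1; apply: hpoly_sub => v vnz; split => //.
exists (fun=> v); split => //; exists 1 => i; by rewrite big_ord1 mul1r.
Qed.
End PrimeSets.

Section HadamardPowers.
Variables (R : realType) (N : nat) (X : pset R N).
Local Notation C := (R[i]).
Local Notation S := {mpoly C[N.+1]}.

Lemma hdecompS k q : hdecomp X k.+1 q <-> nonzero q /\ hadset X (hdecomp X k) q.
Proof.
split.
  move=> [qnz [ps [Xps [c qE]]]]; split => //.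
  exists (ps ord0), (fun i => c * \prod_(j < k) ps (lift ord0 j) i); split => //.
    split.
      have [k0] := qnz; rewrite qE big_ord_recl mulrCA mulf_eq0 negb_or => /andP[_ h].
      by exists k0.
    by exists (fun j => ps (lift ord0 j)); split => //; exists c.
  by move=> i; rewrite qE big_ord_recl mulrCA.
move=> [qnz [x [y [Xx [_ [ps [Xps [c yE]]]] qE]]]]; split => //.
exists (fun j => if unlift ord0 j is Some j' then ps j' else x); split.
  by move=> j; case: unlift.
exists c => i; rewrite qE yE big_ord_recl unlift_none mulrCA; congr (_ * (_ * _)).
by apply: eq_bigr => j _; rewrite liftK.
Qed.

Lemma hdecomp0 q : hdecomp X 0 q <-> nonzero q /\ exists c, forall i, q i = c.
Proof.
split=> [[qnz [ps [_ [c qE]]]]|[qnz [c qE]]]; split => //.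
  by exists c => i; rewrite qE big_ord0 mulr1.
by exists (fun=> q); split=> [[]//|]; exists c => i; rewrite qE big_ord0 mulr1.
Qed.

Lemma hdecomp0_closed : zclosed (hdecomp X 0).
Proof.
apply: zclosed_of_sub => [v []//|v [vnz hv]]; apply/hdecomp0; split => //.
exists (v ord0) => i; apply/eqP; rewrite -subr_eq0; apply/eqP.
have := hv ('X_i - 'X_ord0); rewrite mevalB !mevalXU; apply.
  by exists 1%N; rewrite rpredB ?dhomogXi.
by move=> w /hdecomp0[_ [c wE]]; rewrite mevalB !mevalXU !wE subrr.
Qed.

Lemma hdecomp0_prime : prime_set (hdecomp X 0).
Proof.
have key h : is_homog h -> h.@[fun=> 1] = 0 -> vanishes h (hdecomp X 0).
  move=> [d hd] h1 v /hdecomp0[_ [c vE]].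
  rewrite (meval_eq (v2 := fun=> c * 1)) => [|i]; last by rewrite vE mulr1.
  by rewrite (meval_scale _ _ hd) h1 mulr0.
move=> f g hf hg fg.
have /fg/eqP : hdecomp X 0 (fun=> 1).
  by apply/hdecomp0; split; [exists ord0; exact: oner_neq0|exists 1].
by rewrite mulf_eq0 => /orP[] /eqP h; [left|right]; apply: key.
Qed.

Definition zeros (v : pt R N) := [set i | v i == 0].

Lemma nonzero_zeros (v : pt R N) : (#|zeros v| <= N)%N -> nonzero v.
Proof.
move=> h; apply: contrapT => nz.
suff : #|zeros v| = N.+1 by move=> e; rewrite e ltnn in h.
rewrite -[RHS]card_ord; apply: eq_card => i; rewrite inE.
by apply/idP; apply: contraT => vi; case: nz; exists i.
Qed.

Lemma zeros_had (v w : pt R N) : zeros (had v w) = zeros v :|: zeros w.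
Proof. by apply/setP => i; rewrite !inE mulf_eq0. Qed.

Hypothesis cX : zclosed X.
Hypothesis Xzeros : forall v, X v -> (#|zeros v| <= 1)%N.

Lemma hdecomp_zeros k q : hdecomp X k q -> (#|zeros q| <= k)%N.
Proof.
elim: k q => [|k IH] q.
  move=> /hdecomp0[[i0 h0] [c qE]]; rewrite leqn0 cards_eq0; apply/eqP/setP => i.
  by rewrite !inE qE -(qE i0) (negPf h0).
move=> /hdecompS[_ [x [y [Xx hy qE]]]].
have -> : zeros q = zeros (had x y) by apply/setP => i; rewrite !inE qE.
rewrite zeros_had (leq_trans (leq_card_setU _ _)) //.
by apply: (@leq_add _ _ 1); [exact: Xzeros|exact: IH].
Qed.

Lemma had_nonzero k x y : (k < N)%N -> X x -> hdecomp X k y -> nonzero (had x y).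
Proof.
move=> kN Xx hy; apply: nonzero_zeros; rewrite zeros_had.
rewrite (leq_trans (leq_card_setU _ _)) // (leq_trans _ kN) //.
by apply: (@leq_add _ _ 1); [exact: Xzeros|exact: hdecomp_zeros].
Qed.

Lemma hdecompS_hadset k : (k < N)%N -> hdecomp X k.+1 = hadset X (hdecomp X k).
Proof.
move=> kN; apply: funext => q; apply: propext; rewrite hdecompS.
split=> [[]//|h]; split => //; have [x [y [Xx hy qE]]] := h.
by have [i hi] := had_nonzero kN Xx hy; exists i; rewrite qE.
Qed.

Lemma hdecomp_closed k : (k <= N)%N -> zclosed (hdecomp X k).
Proof.
elim: k => [|k IH] kN; first exact: hdecomp0_closed.
rewrite hdecompS_hadset //; apply: hadset_closed => //.
  by apply: IH; exact: ltnW.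
by move=> x y; exact: had_nonzero.
Qed.

Lemma hdecomp_prime k : prime_set X -> (k <= N)%N -> prime_set (hdecomp X k).
Proof.
move=> pX; elim: k => [|k IH] kN; first exact: hdecomp0_prime.
by rewrite hdecompS_hadset //; apply: prime_hadset => //; apply: IH; exact: ltnW.
Qed.

Lemma zclosure_sub (A B : pset R N) : zclosed B -> psubset A B -> psubset (zclosure A) B.
Proof.
move=> cB AB v [vnz hv]; apply/cB; split => // f hf fB.
by apply: hv => // w /AB /fB.
Qed.

Lemma hpow_hdecomp k : (k <= N)%N -> hpow X k = hdecomp X k.
Proof.
elim: k => [|k IH] kN; apply: funext => q; apply: propext.
  split; first apply: zclosure_sub; first exact: hdecomp0_closed.
    move=> v vE; apply/hdecomp0; split; last by exists 1.
    by exists ord0; rewrite vE oner_neq0.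
  move=> /hdecomp0[qnz [c qE]]; split => // f [d hd] fS.
  rewrite (meval_eq (v2 := fun=> c * 1)) => [|i]; last by rewrite qE mulr1.
  by rewrite (meval_scale _ _ hd) fS ?mulr0.
rewrite /= IH 1?ltnW //; split.
  apply: zclosure_sub; first exact: hdecomp_closed.
  move=> u [v [w [Xv [hw [nz uE]]]]]; rewrite hdecompS_hadset //.
  by exists v, w.
move=> hq; have [qnz _] := hq; apply: sub_zclosure => //.
move: hq; rewrite hdecompS_hadset // => -[x [y [Xx hy qE]]].
by exists x, y; split => //; split => //; split => //; exact: had_nonzero hy.
Qed.

Lemma hdecomp_const a k : (forall i, a i != 0) -> X a -> hdecomp X k (fun i => a i ^+ k).
Proof.
move=> a0 Xa; split; first by exists ord0; rewrite expf_neq0.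
by exists (fun=> a); split => //; exists 1 => i; rewrite mul1r prodr_const card_ord.
Qed.

(* The products of points of [X] on distinct coordinate hyperplanes show that
   the powers of [X] grow: they have more zeros than shorter products allow. *)
Hypothesis Xmeets : forall i, exists b, X b /\ b i = 0.

Lemma hdecomp_many_zeros k : (k <= N)%N -> exists q, hdecomp X k q /\ (k <= #|zeros q|)%N.
Proof.
suff H : (k <= N)%N -> exists q, hdecomp X k q /\ forall i : 'I_N.+1, (i < k)%N -> q i = 0.
  move=> kN; have [q [hq q0]] := H kN; exists q; split => //.
  have wI : injective (widen_ord (leqW kN)) by move=> i j e; apply: val_inj; exact: (congr1 val e).
  rewrite -[k in (k <= _)%N]card_ord -(card_imset _ wI).
  apply: subset_leq_card; apply/subsetP => _ /imsetP[j _ ->]; rewrite inE.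
  by apply/eqP/q0; exact: (ltn_ord j).
elim: k => [|k IH] kN.
  exists (fun=> 1); split => //; apply/hdecomp0; split; last by exists 1.
  by exists ord0; exact: oner_neq0.
have [q [hq q0]] := IH (ltnW kN).
have [b [Xb bk]] := Xmeets (inord k).
exists (had b q); split; first by rewrite hdecompS_hadset //; exists b, q.
move=> i; rewrite ltnS leq_eqVlt => /orP[/eqP ik|/q0 qi]; last by rewrite /had qi mulr0.
by rewrite /had -(inord_val i) ik bk mul0r.
Qed.

Hypothesis pX : prime_set X.
Variable a : pt R N.
Hypothesis Xa : X a.
Hypothesis a0 : forall i, a i != 0.

(** The multiple of the [k]-th power of [X] by the [(r - k)]-th power of [a]. Trading one factor [a]
    for an arbitrary point of [X] leads into the next member. *)
Definition tower r k : pset R N := translate (fun i => (a i ^+ (r - k))^-1) (hdecomp X k).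

Lemma tower_irreducible r k : (k <= r <= N)%N -> irreducible (tower r k).
Proof.
move=> /andP[kr rN]; have kN := leq_trans kr rN.
have u0 i : (a i ^+ (r - k))^-1 != 0 by rewrite invr_eq0 expf_neq0.
apply: prime_irreducible.
- by apply: translate_closed => //; apply: hdecomp_closed.
- exists (fun i => a i ^+ r); rewrite /tower /translate.
  suff -> : had (fun i => (a i ^+ (r - k))^-1) (fun i => a i ^+ r) = fun i => a i ^+ k.
    exact: hdecomp_const.
  apply: funext => i; rewrite /had -{2}(subnK kr) exprD mulKf //.
  by rewrite expf_neq0.
- by apply: translate_prime => //; apply: hdecomp_prime.
Qed.

Lemma tower_inc r k : (k < r <= N)%N ->
  psubset (tower r k) (tower r k.+1) /\ ~ psubset (tower r k.+1) (tower r k).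
Proof.
move=> /andP[kr rN]; have kN := leq_trans kr rN.
have aS i : a i ^+ (r - k) = a i * a i ^+ (r - k.+1) by rewrite -exprS subnSK.
have ae e i : a i ^+ e != 0 by rewrite expf_neq0.
split.
  move=> v hv; rewrite /tower /translate hdecompS_hadset //.
  exists a, (had (fun i => (a i ^+ (r - k))^-1) v); split => // i.
  by rewrite /had aS invfM -!mulrA mulVKf.
(* This [q] has at least [k.+1] zeros, and multiplying by powers of [a] keeps them; a point of
   [tower r k] has at most [k]. *)
have [q [hq qz]] := hdecomp_many_zeros kN.
move=> /(_ (fun i => a i ^+ (r - k.+1) * q i)) h.
have /h/hdecomp_zeros : tower r k.+1 (fun i => a i ^+ (r - k.+1) * q i).
  rewrite /tower /translate; suff -> : had (fun i => (a i ^+ (r - k.+1))^-1)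
    (fun i => a i ^+ (r - k.+1) * q i) = q by [].
  by apply: funext => i; rewrite /had mulKf.
rewrite leqNgt; apply/negP; rewrite negbK; apply: leq_trans qz _.
by apply: subset_leq_card; apply/subsetP => i; rewrite !inE => /eqP e; rewrite /had e !mulr0.
Qed.

Lemma tower_last r : tower r r = hdecomp X r.
Proof.
apply: funext => v; rewrite /tower /translate subnn; congr (hdecomp X r _).
by apply: funext => i; rewrite /had expr0 invr1 mul1r.
Qed.

Lemma irr_chain_Heta r : (1 <= r <= N)%N -> irr_chain (Heta X r) r.
Proof.
move=> /andP[r1 rN]; exists (tower r); split; [|split].
- by move=> i ir; apply: tower_irreducible; rewrite ir.
- by move=> i ir; apply: tower_inc; rewrite ir.
- rewrite tower_last => v hv; have [vnz _] := hv; apply: sub_zclosure => //.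
  by exists r; rewrite r1 leqnn.
Qed.

(* Otherwise the tower over [X^N] extends to a chain of length [N + 1] in [P^N]. *)
Lemma hdecomp_full q : nonzero q -> hdecomp X N q.
Proof.
move=> qnz; apply: contrapT => nq; apply: (no_long_chain (@hpoly_nonzero R N)).
exists (fun k => if (k <= N)%N then tower N k else @nonzero R N); split; [|split].
- move=> i iN; case: ifP => h; first by apply: tower_irreducible; rewrite h leqnn.
  apply: prime_irreducible; [exact: nonzero_closed|by exists q|exact: nonzero_prime].
- move=> i; rewrite ltnS => iN; rewrite iN.
  have [lt|] := ltnP i N; first by apply: tower_inc; rewrite lt leqnn.
  move=> Ni; have -> : i = N by apply/eqP; rewrite eqn_leq iN.
  rewrite tower_last; split; first by move=> v [].
  by move=> /(_ q qnz).
- by rewrite ltnn.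
Qed.

(** [Heta] closes a union, so a single form must vanish on all the powers involved and not at [v]: a
    product of one form for each length. The point [v] has [N] zeros, too many for fewer than [N]
    factors. *)
Lemma Heta_proper r : (r < N)%N -> exists v, nonzero v /\ ~ Heta X r v.
Proof.
move=> rN; have [v [hv vz]] := hdecomp_many_zeros (leqnn N).
have [vnz _] := hv; exists v; split => //.
suff [f [hf fV fv]] : exists f : S, [/\ is_homog f,
    forall k, (1 <= k <= r)%N -> vanishes f (hdecomp X k) & f.@[v] != 0].
  move=> [_ /(_ f hf) h]; move: fv; rewrite h ?eqxx // => w [k [kr hw]].
  exact: fV kr w hw.
elim: r rN => [|r IH] rN.
  exists 1; split; first by exists 0%N; apply: dhomog1.
    by move=> k; case: k.
  by rewrite meval1 oner_neq0.
have [f [hf fV fv]] := IH (ltnW rN).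
have nr : ~ hdecomp X r.+1 v.
  by move=> /hdecomp_zeros h; have := leq_trans vz h; rewrite leqNgt rN.
have [g [hg gV gv]] := not_in_zclosed (hdecomp_closed (ltnW rN)) vnz nr.
exists (f * g); split; first exact: homogM.
  move=> k /andP[k1]; rewrite leq_eqVlt => /orP[/eqP -> w /gV gw|kr w hw].
    by rewrite mevalM gw mulr0.
  by rewrite mevalM (fV k) ?mul0r // k1.
by rewrite mevalM mulf_neq0.
Qed.
End HadamardPowers.

(** * Curves avoiding the codimension-two coordinate strata *)

Section Curve.
Variables (R : realType) (N : nat) (X : pset R N).
Local Notation C := (R[i]).
Local Notation S := {mpoly C[N.+1]}.
Hypothesis N2 : (2 <= N)%N.
Hypothesis irrX : irreducible X.
Hypothesis XDelta : forall v, X v -> ~ Delta v.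

Let cX : zclosed X := irrX.1.

Lemma at_most_one_zero v i j : X v -> v i = 0 -> v j = 0 -> i = j.
Proof.
move=> Xv vi vj; apply/eqP; apply: contraT => ij; case: (XDelta Xv).
by split; [exact: zclosed_nonzero Xv|exists i, j].
Qed.

Lemma card_zeros_le1 v : X v -> (#|zeros v| <= 1)%N.
Proof.
move=> Xv; apply/card_le1_eqP => i j; rewrite !inE => /eqP vi /eqP vj.
exact: at_most_one_zero Xv vj vi.
Qed.

(* Two coordinates have no common zero on [X], so they form a system of
   parameters and the Hilbert function of [X] grows at most linearly. *)
Lemma hpoly_span_curve : hpoly_span X 1.
Proof.
have lt0 : (0 < N.+1)%N by [].
have lt1 : (1 < N.+1)%N by rewrite ltnS ltnW.
pose w (l : 'I_2) : S := if l == ord0 then 'X_(Ordinal lt0) else 'X_(Ordinal lt1).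
apply: (@hpoly_span_of_forms R N X 1 w) => //.
  by move=> l; rewrite /w; case: ifP => _; exact: dhomogXi.
move=> v Xv; have [v0|v0] := eqVneq (v (Ordinal lt0)) 0; last first.
  by exists ord0; rewrite /w eqxx mevalXU.
exists ord_max; rewrite /w /= mevalXU; apply/eqP => v1.
by have /(congr1 val) := at_most_one_zero Xv v0 v1.
Qed.

(** If [X] missed the hyperplane, the single form ['X_i] would have no zero on [X] and the Hilbert
    function would be bounded, which forbids even a chain of length 1. *)
Lemma meets_hyperplanes : irr_chain X 1 -> forall i, exists b, X b /\ b i = 0.
Proof.
move=> chX i; apply: contrapT => Hi.
have : hpoly_span X 0.
  apply: (@hpoly_span_of_forms R N X 0 (fun=> 'X_i)) => //.
    by move=> _; exact: dhomogXi.
  move=> v Xv; exists ord0; rewrite mevalXU; apply/eqP => vi.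
  by apply: Hi; exists v.
move=> /(hpoly_hdecomp 1); rewrite mul0n => h.
apply: (no_long_chain _ chX); apply: hpoly_sub h => v Xv.
split; first exact: zclosed_nonzero Xv.
by exists (fun=> v); split => //; exists 1 => j; rewrite big_ord1 mul1r.
Qed.

Lemma prime_prod_coordinates (s : seq 'I_N.+1) :
  vanishes (\prod_(i <- s) 'X_i) X -> exists i, vanishes 'X_i X.
Proof.
have [v0 Xv0] := irrX.2.1.
elim: s => [|i s IH] h.
  by have := h v0 Xv0; rewrite big_nil meval1 => /eqP; rewrite oner_eq0.
have hs : is_homog (\prod_(j <- s) 'X_j : S).
  by exists (\sum_(j <- s) 1)%N; apply: dhomog_bigprod => j _; exact: dhomogXi.
case: (irreducible_prime irrX _ hs (f := 'X_i)) => [|v /h|hi|/IH //].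
- by exists 1%N; exact: dhomogXi.
- by rewrite big_cons mevalM.
- by exists i.
Qed.

(** Otherwise the product of all coordinates vanishes on [X], hence by primality some coordinate [i]
    does; a point of [X] on another hyperplane [j] then has two zeros. *)
Lemma exists_full_point : (forall i, exists b, X b /\ b i = 0) ->
  exists a, X a /\ forall i, a i != 0.
Proof.
move=> Xmeets; apply: contrapT => H.
have [v Xv|i hi] := @prime_prod_coordinates (enum 'I_N.+1).
  apply: contrapT => /eqP hv; apply: H; exists v; split => // i.
  apply: contraNneq hv => vi; rewrite big_enum /= (bigD1 i) //= mevalM mevalXU.
  by rewrite vi mul0r.
have [j ij] : exists j : 'I_N.+1, i != j.
  have [->|h] := eqVneq i ord0; last by exists ord0.
  by exists (inord 1); apply/eqP => /(congr1 val); rewrite /= inordK // ltnS ltnW.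
have [b [Xb bj]] := Xmeets j.
have bi : b i = 0 by have := hi b Xb; rewrite mevalXU.
by move: ij; rewrite (at_most_one_zero Xb bi bj) eqxx.
Qed.
End Curve.

Lemma exists_minimal (P : nat -> Prop) n : P n ->
  exists m, [/\ (m <= n)%N, P m & forall k, (k < m)%N -> ~ P k].
Proof.
elim/ltn_ind: n => n IH Pn.
have [[k [kn Pk]]|H] := pselect (exists k, (k < n)%N /\ P k).
  have [m [mk Pm hm]] := IH k kn Pk.
  by exists m; split => //; apply: leq_trans mk (ltnW kn).
by exists n; split => // k kn Pk; apply: H; exists k.
Qed.

Theorem mainTheorem11 (R : realType) (N : nat) (X : pset R N) :
  (2 <= N)%N ->
  irreducible_curve X ->
  (forall v, X v -> ~ Delta v) ->
  (forall r, (1 <= r <= N)%N -> has_dim (Heta X r) r) /\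
  (forall p : pt R N, nonzero p ->
     exists m, Hrk_eq X p m /\ bHrk_eq X p m /\ (m <= N)%N) /\
  (exists Z : pset R N, zclosed Z /\ (exists v, nonzero v /\ ~ Z v) /\
     forall p : pt R N, nonzero p -> ~ Z p -> Hrk_eq X p N).
Proof.
move=> N2 [irrX [chX _]] XDelta.
have cX := irrX.1; have pX := irreducible_prime irrX.
have Xz := card_zeros_le1 irrX XDelta.
have Xm := meets_hyperplanes irrX chX.
have [a [Xa a0]] := exists_full_point N2 irrX XDelta Xm.
have full := hdecomp_full cX Xz Xm pX Xa a0.
have N1 : (1 <= N)%N := ltnW N2.
split; [|split].
- move=> r rN; split; first exact: (irr_chain_Heta cX Xz Xm pX Xa a0 rN).
  apply: no_long_chain; apply: hpoly_Heta; exact: hpoly_span_curve.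
- move=> p pnz.
  have [|m [mN [m1 hm] mmin]] := @exists_minimal (fun m => (1 <= m)%N /\ hdecomp X m p) N.
    by split => //; exact: full.
  exists m; split; [|split => //]; split => //; split => //.
  + by move=> k /andP[k1 km] hk; apply: (mmin k km).
  + by rewrite hpow_hdecomp.
  + move=> k /andP[k1 km]; rewrite hpow_hdecomp //; last first.
      exact: leq_trans (ltnW km) mN.
    by move=> hk; apply: (mmin k km).
(* Genericity: all points of rank below [N] lie in this proper closed set. *)
exists (Heta X N.-1); split; [|split].
- exact: zclosure_closed.
- by apply: Heta_proper => //; rewrite prednK.
- move=> p pnz nZ; split => //; split; first exact: full.
  move=> k /andP[k1 kN] hk; apply: nZ; apply: sub_zclosure => //.
  by exists k; split => //; rewrite k1 -ltnS prednK.
Qed.
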